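(* There exists an absolute constant $C>0$ such that the following holds. Let $d,\bar s\in\mathbb{Z}_+$ with $\bar s\le d/2$, let $\beta_{\min},\omega,\sigma^2>0$ and $\delta\in(0,1)$. Let $\overline{\mathcal{M}}$ be the class of Gaussian linear models $(\beta,\Sigma,\sigma^2)$ with $\beta\in\Theta_{d}^{\bar s}(\beta_{\min})$ and $\Sigma\in\Omega_{d}^{\bar s}(\omega)$. Let $(\beta,\Sigma,\sigma^2)\in\overline{\mathcal{M}}$, let $S_*=\operatorname{supp}(\beta)$, and suppose $n$ i.i.d. samples from $P_{\beta,\Sigma,\sigma^2}$ are given, collected in $X\in\mathbb{R}^{n\times d}$ and $Y\in\mathbb{R}^n$. Choose $\tau=\frac14\,\omega\,\beta_{\min}^2$ and define $$\widehat S=\operatorname*{arg\,min}_{S\subseteq\{1,\dots,d\},\ |S|\le\bar s}\ \frac{\|\Pi_S^\perp Y\|^2}{n-|S|}+|S|\,\tau .$$ If $$ n\ \ge\ C\max\bigg\{\frac{\log d+\log(1/\delta)}{\beta_{\min}^2\,\omega/\sigma^2},\ \log\binom{d}{\bar s}+\log(1/\delta)\bigg\}, $$ then $\mathbb{P}_{\beta,\Sigma,\sigma^2}(\widehat S=S_* )\ge 1-\delta$.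
   Context: Model: $P_{\beta,\Sigma,\sigma^2}$ is the law of $(X,Y)\in\mathbb{R}^d\times\mathbb{R}$ with $Y=X^\top\beta+\epsilon$, $X\sim\mathcal{N}(0,\Sigma)$, $\epsilon\sim\mathcal{N}(0,\sigma^2)$, $X$ independent of $\epsilon$. With $n$ i.i.d. samples, $X$ and $Y$ also denote the $n\times d$ data matrix and the response vector in $\mathbb{R}^n$; $X_S$ is the submatrix of columns indexed by $S$, and $\Pi_S^\perp=I_n-X_S(X_S^\top X_S)^{-1}X_S^\top$ is the projection onto the orthogonal complement of the column space of $X_S$ ($\Pi_\emptyset^\perp=I_n$). Let $\mathcal{S}_d^{\bar s}=\{S\subseteq\{1,\dots,d\}:|S|\le\bar s\}$. For $\Sigma$ positive definite and index sets $S,T$, $\Sigma_{ST}$ is the submatrix with rows $S$ and columns $T$, and $\Sigma_{S\setminus T\mid T}=\Sigma_{(S\setminus T)(S\setminus T)}-\Sigma_{(S\setminus T)T}\Sigma_{TT}^{-1}\Sigma_{T(S\setminus T)}$ (for $T=\emptyset$ this is $\Sigma_{SS}$). $\Theta_d^{\bar s}(\beta_{\min})=\{\beta\in\mathbb{R}^d:\ \|\beta\|_0\le\bar s,\ |\beta_j|\ge\beta_{\min}\text{ for all } j\in\operatorname{supp}(\beta)\}$, where $\|\beta\|_0=|\operatorname{supp}(\beta)|$. $\Omega_d^{\bar s}(\omega)$ is the set of $d\times d$ positive definite matrices $\Sigma$ with $\lambda_{\min}(\Sigma_{S\setminus T\mid T})\ge\omega$ for all $S,T\in\mathcal{S}_d^{\bar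 s}$ with $S\not\subseteq T$. *)

(* Defs.v *)
From HB Require Import structures.
From mathcomp Require Import all_boot all_order all_algebra.
From mathcomp Require Import all_classical all_reals all_analysis.

Set Implicit Arguments.
Unset Strict Implicit.
Unset Printing Implicit Defensive.

Import Order.TTheory GRing.Theory Num.Theory.
Import numFieldNormedType.Exports.

Local Open Scope classical_set_scope.
Local Open Scope ring_scope.

Section LinearAlgebra.
Context {R : realType}.

Definition subset_mx {d : nat} (A : 'M[R]_d) (S T : {set 'I_d}) :
    'M[R]_(#|S|, #|T|) :=
  mxsub (fun i : 'I_#|S| => enum_val i) (fun j : 'I_#|T| => enum_val j) A.

Definition subset_cols {n d : nat} (X : 'M[R]_(n, d)) (S : {set 'I_d}) :
    'M[R]_(n, #|S|) :=
  colsub (fun j : 'I_#|S| => enum_val j) X.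

(* Sigma_{S \ T | T}.  For T = set0 the inner dimension is 0, so the
   subtracted product vanishes. *)
Definition cond_cov {d : nat} (Sigma : 'M[R]_d) (S T : {set 'I_d}) :
    'M[R]_(#|S :\: T|) :=
  subset_mx Sigma (S :\: T) (S :\: T)
  - subset_mx Sigma (S :\: T) T *m invmx (subset_mx Sigma T T)
    *m subset_mx Sigma T (S :\: T).

Definition posdef {d : nat} (A : 'M[R]_d) : Prop :=
  A^T = A /\
  forall u : 'cV[R]_d, u != 0 -> 0 < (u^T *m A *m u) ord0 ord0.

(* The infimum is a minimum for a symmetric matrix of positive size; it is
   only ever applied to such matrices. *)
Definition lambda_min {m : nat} (A : 'M[R]_m) : R :=
  inf [set a : R | eigenvalue A a].

Definition supp {d : nat} (beta : 'cV[R]_d) : {set 'I_d} :=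
  [set j | beta j ord0 != 0]%SET.

(* Squared Euclidean norm; the norm `| _ | of MathComp-Analysis on matrices is
   the sup norm. *)
Definition sqnorm {n : nat} (v : 'cV[R]_n) : R := \sum_i v i ord0 ^+ 2.

Definition proj_perp {n d : nat} (X : 'M[R]_(n, d)) (S : {set 'I_d}) :
    'M[R]_n :=
  1%:M - subset_cols X S *m invmx ((subset_cols X S)^T *m subset_cols X S)
         *m (subset_cols X S)^T.

Definition Theta (d sbar : nat) (beta_min : R) : set 'cV[R]_d :=
  [set beta | (#|supp beta| <= sbar)%N /\
    forall j, j \in supp beta -> beta_min <= `|beta j ord0|].

Definition Omega (d sbar : nat) (omega : R) : set 'M[R]_d :=
  [set Sigma | posdef Sigma /\
    forall S T : {set 'I_d}, (#|S| <= sbar)%N -> (#|T| <= sbar)%N ->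
      ~~ (S \subset T) -> omega <= lambda_min (cond_cov Sigma S T)].

Definition score {n d : nat} (tau : R) (X : 'M[R]_(n, d)) (Y : 'cV[R]_n)
    (S : {set 'I_d}) : R :=
  sqnorm (proj_perp X S *m Y) / (n%:R - #|S|%:R) + #|S|%:R * tau.

Definition is_argmin {n d : nat} (sbar : nat) (tau : R)
    (X : 'M[R]_(n, d)) (Y : 'cV[R]_n) (S : {set 'I_d}) : Prop :=
  (#|S| <= sbar)%N /\
  forall S' : {set 'I_d}, (#|S'| <= sbar)%N -> score tau X Y S <= score tau X Y S'.

End LinearAlgebra.

Section Probability.
Context {disp : measure_display} {T : measurableType disp} {R : realType}
  {P : probability T R}.

Definition has_normal_law (m s2 : R) (Z : {RV P >-> R}) : Prop :=
  forall A : set R, measurable A ->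
    distribution P Z A = normal_prob m (Num.sqrt s2) A.

Definition independent2 {d1 d2 : measure_display} {T1 : measurableType d1}
    {T2 : measurableType d2} (U : {RV P >-> T1}) (V : {RV P >-> T2}) : Prop :=
  forall (A : set T1) (B : set T2), measurable A -> measurable B ->
    P (U @^-1` A `&` V @^-1` B) = (P (U @^-1` A) * P (V @^-1` B))%E.

Definition mutually_independent {d1 : measure_display} {T1 : measurableType d1}
    {I : finType} (Z : I -> {RV P >-> T1}) : Prop :=
  forall (J : {set I}) (A : I -> set T1), (forall i, measurable (A i)) ->
    P (\bigcap_(i in [set i | i \in J]) (Z i @^-1` A i)) =
    (\prod_(i in J) P (Z i @^-1` A i))%E.

(* X ~ N(0, Sigma), i.e. X = L Z with L L^T = Sigma and Z a vector of
   independent standard normal variables.  Asking for Z on the same probability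
   space is no restriction when Sigma is positive definite: Z = L^-1 X. *)
Definition has_mvnormal_law {d : nat} (Sigma : 'M[R]_d)
    (X : {RV P >-> d.-tuple R}) : Prop :=
  exists (L : 'M[R]_d) (Z : 'I_d -> {RV P >-> R}),
    [/\ L *m L^T = Sigma,
        forall k, has_normal_law 0 1 (Z k),
        mutually_independent Z &
        forall w j, tnth (X w) j = \sum_k L j k * Z k w].

Definition has_linear_model_law {d : nat} (beta : 'cV[R]_d) (Sigma : 'M[R]_d)
    (sigma2 : R) (XY : {RV P >-> (d.-tuple R * R)%type}) : Prop :=
  exists (X : {RV P >-> d.-tuple R}) (eps : {RV P >-> R}),
    [/\ has_mvnormal_law Sigma X,
        has_normal_law 0 sigma2 eps,
        independent2 X eps &
        forall w, XY w =
          (X w, \sum_j tnth (X w) j * beta j ord0 + eps w)].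

Definition iid_linear_model {n d : nat} (beta : 'cV[R]_d) (Sigma : 'M[R]_d)
    (sigma2 : R) (XY : 'I_n -> {RV P >-> (d.-tuple R * R)%type}) : Prop :=
  mutually_independent XY /\
  forall i, has_linear_model_law beta Sigma sigma2 (XY i).

Definition data_X {n d : nat} (XY : 'I_n -> {RV P >-> (d.-tuple R * R)%type})
    (w : T) : 'M[R]_(n, d) :=
  \matrix_(i, j) tnth (XY i w).1 j.

Definition data_Y {n d : nat} (XY : 'I_n -> {RV P >-> (d.-tuple R * R)%type})
    (w : T) : 'cV[R]_n :=
  \col_i (XY i w).2.

End Probability.

(* Main.v *)
(** For a competitor S of S0 = supp beta put k = |S0 \ S|, l = |S \ S0|, and let
    h = Pi_S^perp X beta, Q = Pi_S - Pi_(S cap S0). Up to the different normalizations,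
    n times the score of S exceeds n times that of S0 by at least
    |h|^2 + 2 <h, e> - e^T Q e + (l - k) n tau, where e is the noise; here Q is a
    projection of rank l and Q h = 0.

    The signal |h|^2 is bounded below on an event that depends on X only. There
    X^T X is at least n Sigma / 2 on the vectors supported on S cup S0: a unit vector
    violating this could be rounded to one of exp(O(|S cup S0|)) lattice vectors b
    with |X b|^2 too small, and each of these has probability exp(- c n). Completing
    the square then gives |h|^2 >= 2 n k tau. Conditionally on X the noise term is
    handled by Chernoff's bound, since E exp (lam e^T Q e + <h, e>) is explicit, and S
    wins with probability at most exp (- c (k + l) n tau / sigma2). It remains to sum
    over S; the sum of y^(k + l) over all S is (1 + y)^d. *)

(* The two terms in the bound on [n] come from two different unions. How well the design is
   conditioned has nothing to do with the signal-to-noise ratio, so its failure may be charged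
   separately to each of the at most C(d, sbar)^2 competitors. The noise may cost only log d per
   index on which S and S0 differ, so its tail must decay at one common rate in missing and in extra
   indices: the signal |h|^2 pays for the former, the penalty for the latter.

   Two obstacles shape the comparison. The divisors n - |S| differ, which is harmless only while the
   mean squared residual of S0 is of order sigma2; hence the extra event |e|^2 > 4 sigma2 n. And
   Pi_S - Pi_S0 is a difference of projections; enlarging the residual of S0 to that of S cap S0
   leaves the single projection Q.

   Rounding to a lattice takes the place of an epsilon-net. It uses the images of the vectors of one
   Sigma-orthonormal basis instead of an operator norm, and the weights exp(- |z|^2) count lattice
   points coordinate by coordinate. *)
Require Import Defs.
From HB Require Import structures.
From mathcomp Require Import all_boot all_order all_algebra.
From mathcomp Require Import all_classical all_reals all_analysis.
From mathcomp Require Import measurable_realfun ring lra zify.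

Set Implicit Arguments.
Unset Strict Implicit.
Unset Printing Implicit Defensive.

Import Order.TTheory GRing.Theory Num.Theory.
Import numFieldNormedType.Exports.

Local Open Scope classical_set_scope.
Local Open Scope ring_scope.

(** * Gaussian integrals *)

Section IntegralDensity.
Context {disp : measure_display} {T : measurableType disp} {R : realType}.
Variables (mu nu : {measure set T -> \bar R}) (p : T -> R).
Hypotheses (p0 : forall x, 0 <= p x) (mp : measurable_fun setT p).
Hypothesis nuE : forall A, measurable A -> nu A = (\int[mu]_(x in A) (p x)%:E)%E.

Import HBNNSimple.

Lemma integral_density_indic (A : set T) : measurable A ->
  (\int[nu]_x (\1_A x)%:E = \int[mu]_x ((\1_A x)%:E * (p x)%:E))%E.
Proof.
move=> mA; rewrite integral_indic// setIT nuE// integral_mkcond.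
apply: eq_integral => x _; rewrite patchE indicE.
by case: ifPn => xA; rewrite ?mul1e ?mul0e.
Qed.

Lemma integral_density_nnsfun (f : {nnsfun T >-> R}) :
  (\int[nu]_x (f x)%:E = \int[mu]_x ((f x)%:E * (p x)%:E))%E.
Proof.
under [LHS]eq_integral do rewrite fimfunE -fsumEFin//.
rewrite [LHS]ge0_integral_fsum//; last 2 first.
  - by move=> r; exact/measurable_EFinP/measurableT_comp.
  - by move=> n x _; rewrite EFinM nnfun_muleindic_ge0.
under [RHS]eq_integral.
  move=> x xD; rewrite fimfunE -fsumEFin// muleC ge0_mule_fsumr; last first.
    by move=> r; rewrite EFinM nnfun_muleindic_ge0.
  over.
have mfr r : measurable (f @^-1` [set r]) by [].
rewrite [RHS]ge0_integral_fsum//; last 2 first.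
  - by move=> r; apply: emeasurable_funM; apply/measurable_EFinP => //;
      exact: measurable_funM.
  - move=> n x _; rewrite EFinM mule_ge0//; last by rewrite nnfun_muleindic_ge0.
    by rewrite lee_fin.
apply: eq_fsbigr => r rf.
have r0 : 0 <= r by move: rf; rewrite inE => -[x _ <-].
under eq_integral do rewrite EFinM.
rewrite ge0_integralZl//; last exact/measurable_EFinP.
under [RHS]eq_integral do rewrite EFinM muleCA.
rewrite ge0_integralZl//; last 2 first.
  - by apply: emeasurable_funM; apply/measurable_EFinP.
  - by move=> t _; rewrite mule_ge0 ?lee_fin.
rewrite integral_density_indic//.
by congr (_ * _)%E; apply: eq_integral => x _; rewrite muleC.
Qed.

(** Both sides pass to monotone limits, so approximation by simple functions reduces the identity to
    indicators, where it is [nuE]. *)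
Lemma ge0_integral_density (f : T -> \bar R) :
  measurable_fun setT f -> (forall x, 0 <= f x)%E ->
  (\int[nu]_x f x = \int[mu]_x (f x * (p x)%:E))%E.
Proof.
move=> mf f0; pose f_ := nnsfun_approx measurableT mf.
transitivity (lim (\int[nu]_x (f_ n x)%:E @[n --> \oo])%E).
  rewrite -monotone_convergence//=.
  - apply: eq_integral => ? /[!inE] xD; apply/esym/cvg_lim => //=.
    exact: cvg_nnsfun_approx.
  - by move=> n; exact/measurable_EFinP/measurable_funTS.
  - by move=> n ? _; rewrite lee_fin.
  - by move=> ? _ ? ? mn; rewrite lee_fin; exact/lefP/nd_nnsfun_approx.
transitivity (lim (\int[mu]_x ((f_ n x)%:E * (p x)%:E) @[n --> \oo])%E).
  by apply: congr_lim; apply/funext => n /=; exact: integral_density_nnsfun.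
rewrite -monotone_convergence//=.
- apply: eq_integral => x /[!inE] xD; apply/cvg_lim => //=.
  apply: cvgeZr => //; exact: cvg_nnsfun_approx.
- by move=> n; apply: emeasurable_funM; exact/measurable_EFinP/measurable_funTS.
- by move=> n ? _; rewrite mule_ge0 ?lee_fin.
- move=> ? _ ? ? mn; rewrite lee_wpmul2r ?lee_fin//.
  exact/lefP/nd_nnsfun_approx.
Qed.

End IntegralDensity.

Section GaussianIntegral.
Context {R : realType}.

Lemma ge0_integral_normal_prob (m s : R) (f : R -> \bar R) :
  measurable_fun setT f -> (forall x, 0 <= f x)%E ->
  (\int[normal_prob m s]_x f x =
   \int[lebesgue_measure]_x (f x * (normal_pdf m s x)%:E))%E.
Proof.
move=> mf f0; apply: ge0_integral_density => //.
- exact: normal_pdf_ge0.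
- exact: measurable_normal_pdf.
Qed.

(** Completing the square: with v = 1 - 2 a s^2, the integrand times the density of N(0, s^2) is a
    constant multiple of the density of N(b s^2 / v, s^2 / v). *)
Lemma integral_normal_quad (s a b : R) : s != 0 -> 2 * a * s ^+ 2 < 1 ->
  (\int[normal_prob 0 s]_x (expR (a * x ^+ 2 + b * x))%:E =
   ((Num.sqrt (1 - 2 * a * s ^+ 2))^-1 *
    expR (b ^+ 2 * s ^+ 2 / (2 * (1 - 2 * a * s ^+ 2))))%:E)%E.
Proof.
move=> s0 as1; set v := 1 - 2 * a * s ^+ 2.
have v0 : 0 < v by rewrite subr_gt0.
have s20 : 0 < s ^+ 2 by rewrite exprn_even_gt0.
pose s' := s / Num.sqrt v; pose m' := b * s ^+ 2 / v.
have sv0 : Num.sqrt v != 0 by rewrite gt_eqF// sqrtr_gt0.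
have s'0 : s' != 0 by rewrite mulf_neq0// invr_eq0.
rewrite ge0_integral_normal_prob; last 2 first.
- apply/measurable_EFinP; apply: measurableT_comp => //.
  by apply: measurable_funD; apply: measurable_funM => //; exact: measurable_funX.
- by move=> x; rewrite lee_fin expR_ge0.
have peakE : normal_peak s = (Num.sqrt v)^-1 * normal_peak s'.
  rewrite /normal_peak /s' expr_div_n sqr_sqrtr ?(ltW v0)//.
  have -> : s ^+ 2 / v * pi *+ 2 = v^-1 * (s ^+ 2 * pi *+ 2).
    by rewrite -mulrnAr -mulrnAr mulrAC mulrC mulrA.
  rewrite sqrtrM ?invr_ge0 ?(ltW v0)// sqrtrV ?(ltW v0)// invfM invrK.
  by rewrite mulrA mulVf// mul1r.
transitivity (\int[lebesgue_measure]_x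
   (((Num.sqrt v)^-1 * expR (b ^+ 2 * s ^+ 2 / (2 * v)))%:E *
   (normal_pdf m' s' x)%:E))%E.
  apply: eq_integral => x _; rewrite -!EFinM; congr EFin.
  rewrite !normal_pdfE// peakE -!mulrA mulrCA; congr (_ * _).
  rewrite [LHS]mulrCA [RHS]mulrCA; congr (_ * _).
  rewrite /normal_fun -!expRD; congr expR.
  rewrite /s' /m' expr_div_n sqr_sqrtr ?(ltW v0)// -(mulr_natr (s ^+ 2)).
  rewrite -(mulr_natr (s ^+ 2 / v)).
  have vN0 : v != 0 by rewrite gt_eqF.
  (* Once [a] is eliminated in favour of [v], the only denominators left are [s] and [v]. *)
  have -> : a = (1 - v) / (2 * s ^+ 2) by rewrite /v; field.
  by field; rewrite s0 vN0.
rewrite ge0_integralZl//.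
- by rewrite integral_normal_pdf mule1.
- by apply/measurable_EFinP; exact: measurable_normal_pdf.
- by move=> x _; rewrite lee_fin normal_pdf_ge0.
Qed.

Let idTR : measurableTypeR R -> R := idfun.

#[local] HB.instance Definition _ :=
  @isMeasurableFun.Build _ _ _ _ idTR (@measurable_id _ _ setT).

(* The normal law, transported from the Borel structure [measurableTypeR R] on
   which [normal_prob] lives to the canonical measurable structure of [R]. *)
Definition gauss (s : R) : probability R R :=
  distribution (normal_prob 0 s) idTR.

Lemma integral_gauss_quad (s a b : R) : s != 0 -> 2 * a * s ^+ 2 < 1 ->
  (\int[gauss s]_x (expR (a * x ^+ 2 + b * x))%:E =
   ((Num.sqrt (1 - 2 * a * s ^+ 2))^-1 *
    expR (b ^+ 2 * s ^+ 2 / (2 * (1 - 2 * a * s ^+ 2))))%:E)%E.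
Proof.
move=> s0 as1; rewrite -integral_normal_quad// ge0_integral_distribution//.
apply/measurable_EFinP; apply: measurableT_comp => //.
by apply: measurable_funD; apply: measurable_funM => //; exact: measurable_funX.
Qed.

End GaussianIntegral.

(** * Independence *)

Section TupleIndependence.
Context {disp : measure_display} {T : measurableType disp} {R : realType}
  (P : probability T R).

Definition cylinder {n : nat} {X : Type} (A : 'I_n -> set X) : set (n.-tuple X) :=
  [set x | forall i, A i (tnth x i)].

Lemma measurable_cylinder {d : measure_display} {X : measurableType d} (n : nat)
    (A : 'I_n -> set X) :
  (forall i, measurable (A i)) -> measurable (cylinder A).
Proof.
move=> mA.
rewrite (_ : cylinder A = \bigcap_(i in [set: 'I_n]) (@tnth n X ^~ i @^-1` A i)).
  apply: fin_bigcap_measurable => // i _.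
  by rewrite -[X in measurable X]setTI; exact: measurable_tnth.
by apply/seteqP; split => x /= Ax i; [move=> _; exact: Ax|exact: (Ax i)].
Qed.

(** Cylinders, unlike the one-coordinate sets that define the product sigma-algebra, are stable
    under intersection, as the uniqueness theorem for measures requires. *)
Lemma measurable_tuple_cylinder {d : measure_display} {X : measurableType d}
    (n : nat) :
  (@measurable _ (n.-tuple X)) =
  <<s [set C | exists2 A : 'I_n -> set X,
         (forall i, measurable (A i)) & C = cylinder A] >>.
Proof.
apply/seteqP; split; last first.
  apply: smallest_sub; first exact: sigma_algebra_measurable.
  by move=> _ [A mA ->]; exact: measurable_cylinder.
apply: smallest_sub; first exact: smallest_sigma_algebra.
move=> C /=; rewrite -bigcup_seq/= => -[i _ [B mB <-]]; apply: sub_sigma_algebra.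
exists (fun j => if j == i then B else setT) => [j|]; first by case: ifP.
rewrite setTI; apply/seteqP; split => x /= => [Bx j|/(_ i)]; last by rewrite eqxx.
by case: eqP => // ->.
Qed.

(** As functions of [B], both sides are finite measures: the law of [U] under [P] restricted to [E],
    and the law of [U] scaled by [P E]. Agreement on cylinders therefore suffices. *)
Lemma tuple_indep_event {d : measure_display} {X : measurableType d} (n : nat)
    (U : T -> n.-tuple X) (E : set T) :
  measurable_fun setT U -> measurable E ->
  (forall A : 'I_n -> set X, (forall i, measurable (A i)) ->
    P (U @^-1` cylinder A `&` E) = (P (U @^-1` cylinder A) * P E)%E) ->
  forall B, measurable B -> P (U @^-1` B `&` E) = (P (U @^-1` B) * P E)%E.
Proof.
move=> mU mE UE B mB.
have PE0 : 0 <= fine (P E) by rewrite fine_ge0.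
pose pf (mu : {measure set T -> \bar R}) : {measure set (n.-tuple X) -> \bar R} :=
  pushforward mu U.
pose m1 := pf mU (mrestr P mE).
pose m2 : {measure set (n.-tuple X) -> \bar R} := mscale (NngNum PE0) (pf mU P).
have m1E A : m1 A = P (U @^-1` A `&` E) by [].
have m2E A : m2 A = (P (U @^-1` A) * P E)%E.
  by rewrite /m2/= /mscale/= fineK ?fin_num_measure// muleC.
rewrite -m1E -m2E; pose G := [set C | exists2 A : 'I_n -> set X,
         (forall i, measurable (A i)) & C = cylinder A].
apply: (measure_unique G (fun=> setT)) => //.
- exact: measurable_tuple_cylinder.
- move=> _ _ [A1 mA1 ->] [A2 mA2 ->]; exists (fun i => A1 i `&` A2 i).
    by move=> i; exact: measurableI.
  apply/seteqP; split => x /=; first by move=> [? ?] i; split.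
  by move=> A12; split => i; have [] := A12 i.
- by move=> _; exists (fun=> setT) => //; apply/seteqP; split.
- by rewrite bigcup_const.
- by move=> _ [A mA ->]; rewrite m1E m2E; exact: UE.
- move=> _; rewrite m1E preimage_setT setTI.
  by rewrite (le_lt_trans (probability_le1 _ _))// ltry.
Qed.

(** Cylinders are replaced by general sets one factor at a time, the event of the other factor being
    held fixed. *)
Lemma tuple_indep {d1 d2 : measure_display} {X1 : measurableType d1}
    {X2 : measurableType d2} (n m : nat) (U : T -> n.-tuple X1) (V : T -> m.-tuple X2) :
  measurable_fun setT U -> measurable_fun setT V ->
  (forall A B, (forall i, measurable (A i)) -> (forall i, measurable (B i)) ->
    P (U @^-1` cylinder A `&` V @^-1` cylinder B) =
    (P (U @^-1` cylinder A) * P (V @^-1` cylinder B))%E) ->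
  forall A B, measurable A -> measurable B ->
    P (U @^-1` A `&` V @^-1` B) = (P (U @^-1` A) * P (V @^-1` B))%E.
Proof.
move=> mU mV UV A B mA mB.
have mUp C : measurable C -> measurable (U @^-1` C).
  by move=> mC; rewrite -[X in measurable X]setTI; exact: mU.
have mVp C : measurable C -> measurable (V @^-1` C).
  by move=> mC; rewrite -[X in measurable X]setTI; exact: mV.
apply: tuple_indep_event => //; first exact: mVp.
move=> {mA}A mA; rewrite setIC [RHS]muleC.
apply: tuple_indep_event => //; first by apply: mUp; exact: measurable_cylinder.
by move=> {mB}B mB; rewrite setIC [RHS]muleC; exact: UV.
Qed.

(** The joint law is the product of the two laws, so Tonelli lets the arguments be drawn at separate
    sample points [w] and [w']. The inner integral plays the role of a conditional expectation given
    [U]. *)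
Lemma integral_indep {d1 d2 : measure_display} {X1 : measurableType d1}
    {X2 : measurableType d2} (U : T -> X1) (V : T -> X2) (F : X1 * X2 -> \bar R) :
  measurable_fun setT U -> measurable_fun setT V ->
  (forall A B, measurable A -> measurable B ->
    P (U @^-1` A `&` V @^-1` B) = (P (U @^-1` A) * P (V @^-1` B))%E) ->
  measurable_fun setT F -> (forall x, 0 <= F x)%E ->
  (\int[P]_w F (U w, V w) = \int[P]_w \int[P]_w' F (U w, V w'))%E.
Proof.
move=> mU mV UV mF F0.
have mUV : measurable_fun setT (fun w => (U w, V w)) by exact: measurable_fun_pair.
pose U' : {mfun T >-> X1} := HB.pack U (isMeasurableFun.Build _ _ _ _ _ mU).
pose V' : {mfun T >-> X2} := HB.pack V (isMeasurableFun.Build _ _ _ _ _ mV).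
pose UV' : {mfun T >-> (X1 * X2)%type} :=
  HB.pack (fun w => (U w, V w)) (isMeasurableFun.Build _ _ _ _ _ mUV).
transitivity (\int[distribution P UV']_z F z)%E.
  by rewrite ge0_integral_distribution.
transitivity (\int[distribution P U' \x distribution P V']_z F z)%E.
  apply: eq_measure_integral => A mA _.
  by apply/esym/product_measure_unique => // B C mB mC; exact: UV.
rewrite fubini_tonelli1// ge0_integral_distribution//=; last 2 first.
- exact: measurable_fun_fubini_tonelli_F.
- by move=> x; apply: integral_ge0.
apply: eq_integral => w _; rewrite /fubini_F ge0_integral_distribution//.
exact: measurableT_comp.
Qed.

End TupleIndependence.

Section IndependentFamilies.
Context {disp : measure_display} {T : measurableType disp} {R : realType}
  (P : probability T R).

Lemma mutually_independentT {d : measure_display} {X : measurableType d} (n : nat)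
    (W : 'I_n -> {RV P >-> X}) (A : 'I_n -> set X) :
  mutually_independent W -> (forall i, measurable (A i)) ->
  P [set w | forall i, A i (W i w)] = (\prod_i P (W i @^-1` A i))%E.
Proof.
move=> mi mA; have := mi [set: 'I_n]%SET A mA.
rewrite (_ : \bigcap_(i in _) _ = [set w | forall i, A i (W i w)]); last first.
  by apply/seteqP; split => w /= Aw i; [apply: Aw; rewrite /= inE|move=> _; exact: Aw].
by move=> ->; apply: eq_bigl => i; rewrite inE.
Qed.

Lemma measurable_fun_mktuple {d1 d2 : measure_display} {X : measurableType d1}
    {Y : measurableType d2} (n : nat) (f : 'I_n -> X -> Y) :
  (forall i, measurable_fun setT (f i)) ->
  measurable_fun setT (fun x => [tuple f i x | i < n]).
Proof.
move=> mf; apply/measurable_fun_tnthP => i.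
rewrite (_ : _ \o _ = f i)//; by apply/funext => x /=; rewrite tnth_mktuple.
Qed.

(** Independence across [i] comes from [W], independence of [f i] and [g i] within one coordinate is
    assumed; on cylinders the two factorizations combine. The main instance separates design from
    noise. *)
Lemma integral_indep_tuples {d0 d1 d2 : measure_display} {X : measurableType d0}
    {X1 : measurableType d1} {X2 : measurableType d2} (n : nat)
    (W : 'I_n -> {RV P >-> X}) (f : 'I_n -> X -> X1) (g : 'I_n -> X -> X2)
    (F : n.-tuple X1 * n.-tuple X2 -> \bar R) :
  mutually_independent W ->
  (forall i, measurable_fun setT (f i)) -> (forall i, measurable_fun setT (g i)) ->
  (forall i A B, measurable A -> measurable B ->
    P ((f i \o W i) @^-1` A `&` (g i \o W i) @^-1` B) =
    (P ((f i \o W i) @^-1` A) * P ((g i \o W i) @^-1` B))%E) ->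
  measurable_fun setT F -> (forall x, 0 <= F x)%E ->
  (\int[P]_w F ([tuple f i (W i w) | i < n], [tuple g i (W i w) | i < n]) =
   \int[P]_w \int[P]_w'
     F ([tuple f i (W i w) | i < n], [tuple g i (W i w') | i < n]))%E.
Proof.
move=> mi mf mg fg mF F0.
have mfW i : measurable_fun setT (f i \o W i) by exact: measurableT_comp.
have mgW i : measurable_fun setT (g i \o W i) by exact: measurableT_comp.
apply: (integral_indep (U := fun w => [tuple f i (W i w) | i < n])
  (V := fun w => [tuple g i (W i w) | i < n])) => //.
- exact: (measurable_fun_mktuple mfW).
- exact: (measurable_fun_mktuple mgW).
apply: tuple_indep.
- exact: (measurable_fun_mktuple mfW).
- exact: (measurable_fun_mktuple mgW).
move=> A B mA mB.
have fA i : measurable (f i @^-1` A i).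
  by rewrite -[X in measurable X]setTI; exact: mf.
have gB i : measurable (g i @^-1` B i).
  by rewrite -[X in measurable X]setTI; exact: mg.
have -> : (fun w => [tuple f i (W i w) | i < n]) @^-1` cylinder A =
    [set w | forall i, (f i @^-1` A i) (W i w)].
  by apply/seteqP; split => w /= H i; have := H i; rewrite tnth_mktuple.
have -> : (fun w => [tuple g i (W i w) | i < n]) @^-1` cylinder B =
    [set w | forall i, (g i @^-1` B i) (W i w)].
  by apply/seteqP; split => w /= H i; have := H i; rewrite tnth_mktuple.
have -> : [set w | forall i, (f i @^-1` A i) (W i w)] `&`
    [set w | forall i, (g i @^-1` B i) (W i w)] =
    [set w | forall i, (f i @^-1` A i `&` g i @^-1` B i) (W i w)].
  apply/seteqP; split => w /=; first by move=> [? ?] i; split.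
  by move=> H; split => i; have [] := H i.
rewrite (mutually_independentT (A := fun i => f i @^-1` A i))//.
rewrite (mutually_independentT (A := fun i => g i @^-1` B i))//.
rewrite (mutually_independentT (A := fun i => f i @^-1` A i `&` g i @^-1` B i))//;
  last by move=> i; exact: measurableI.
rewrite -big_split/=; apply: eq_bigr => i _; exact: fg.
Qed.

(* Coordinates outside a sub-family are masked by the constant c, so that disjoint
   sub-families are still functions of the same tuple. *)
Lemma integral_indep_mask {d : measure_display} {X : measurableType d} (n : nat)
    (W : 'I_n -> {RV P >-> X}) (f g : 'I_n -> X -> R) (c : R) (I J : pred 'I_n)
    (F : n.-tuple R * n.-tuple R -> \bar R) :
  mutually_independent W -> (forall i, I i -> ~~ J i) ->
  (forall i, measurable_fun setT (f i)) -> (forall i, measurable_fun setT (g i)) ->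
  measurable_fun setT F -> (forall x, 0 <= F x)%E ->
  (\int[P]_w F ([tuple if I i then f i (W i w) else c | i < n],
                [tuple if J i then g i (W i w) else c | i < n]) =
   \int[P]_w \int[P]_w'
     F ([tuple if I i then f i (W i w) else c | i < n],
        [tuple if J i then g i (W i w') else c | i < n]))%E.
Proof.
move=> mi IJ mf mg mF F0.
apply: (integral_indep_tuples (f := fun i x => if I i then f i x else c)
  (g := fun i x => if J i then g i x else c)) => // [i|i|i A B mA mB].
- by case: (I i).
- by case: (J i).
have [Ii|_] := boolP (I i).
  have /negbTE Ji := IJ _ Ii; rewrite Ji/= /comp.
  have [cB|cB] := pselect (B c).
    rewrite (_ : (fun=> c) @^-1` B = setT); last by apply/seteqP; split.
    by rewrite setIT probability_setT mule1.
  rewrite (_ : (fun=> c) @^-1` B = set0); last by apply/seteqP; split.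
  by rewrite setI0 measure0 mule0.
rewrite /comp; have [cA|cA] := pselect (A c).
  rewrite (_ : (fun=> c) @^-1` A = setT); last by apply/seteqP; split.
  by rewrite setTI probability_setT mul1e.
rewrite (_ : (fun=> c) @^-1` A = set0); last by apply/seteqP; split.
by rewrite set0I measure0 mul0e.
Qed.

(** One factor is split off at a time. Masking by 1 does not change the product over a sub-family,
    so each step is an instance of [integral_indep_mask]. *)
Lemma integral_prod_indep {d : measure_display} {X : measurableType d} (n : nat)
    (W : 'I_n -> {RV P >-> X}) (f : 'I_n -> X -> R) :
  mutually_independent W -> (forall i, measurable_fun setT (f i)) ->
  (forall i x, 0 <= f i x) ->
  (\int[P]_w (\prod_i f i (W i w))%:E = \prod_i \int[P]_w (f i (W i w))%:E)%E.
Proof.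
move=> mi mf f0.
pose m (I : pred 'I_n) w := [tuple if I i then f i (W i w) else 1 | i < n].
pose pr (t : n.-tuple R) := \prod_(i < n) tnth t i.
have mpr : measurable_fun setT pr.
  by apply: measurable_prod => i _; exact: measurable_tnth.
have mm I : measurable_fun setT (m I).
  apply: (measurable_fun_mktuple (f := fun i w => if I i then f i (W i w) else 1)).
  by move=> i; case: (I i) => //; exact: measurableT_comp.
have mf0 I w i : 0 <= tnth (m I w) i by rewrite tnth_mktuple; case: ifP.
have pr0 I w : 0 <= pr (m I w) by apply: prodr_ge0.
have split_int (I J : pred 'I_n) : (forall i, I i -> ~~ J i) ->
    (\int[P]_w (pr (m I w) * pr (m J w))%:E =
     \int[P]_w (pr (m I w))%:E * \int[P]_w (pr (m J w))%:E)%E.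
  (* The absolute value makes [F] nonnegative on all tuples; on the tuples that occur it changes
     nothing. *)
  move=> IJ; pose F (x : n.-tuple R * n.-tuple R) := `| (pr x.1 * pr x.2)%:E |%E.
  transitivity (\int[P]_w F (m I w, m J w))%E.
    by apply: eq_integral => w _; rewrite /F/= ger0_norm// mulr_ge0.
  have F0 x : (0 <= F x)%E by rewrite /F.
  have mF : measurable_fun setT F.
    apply: (measurableT_comp (f := abse)) => //; apply/measurable_EFinP.
    apply: measurable_funM; first exact: (measurableT_comp mpr measurable_fst).
    exact: (measurableT_comp mpr measurable_snd).
  rewrite integral_indep_mask//.
  transitivity (\int[P]_w ((pr (m I w))%:E * \int[P]_w' (pr (m J w'))%:E))%E.
    apply: eq_integral => w _; rewrite -ge0_integralZl ?lee_fin//.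
    - apply: eq_integral => w' _; rewrite /F/= ger0_norm ?EFinM//.
      by apply: mulr_ge0; [exact: (pr0 I w)|exact: (pr0 J w')].
    - by apply/measurable_EFinP; exact: (measurableT_comp mpr (mm J)).
    - by move=> w' _; rewrite lee_fin.
  rewrite ge0_integralZr//.
  - by apply/measurable_EFinP; exact: (measurableT_comp mpr (mm I)).
  - by move=> w _; rewrite lee_fin.
  - by apply: integral_ge0 => w _; rewrite lee_fin.
pose I (j : nat) : pred 'I_n := fun i => (i < j)%N.
suff H j : (j <= n)%N -> (\int[P]_w (pr (m (I j) w))%:E =
    \prod_(i < n | I j i) \int[P]_w (f i (W i w))%:E)%E.
  have := H n (leqnn n).
  rewrite [RHS](eq_bigl xpredT) => [<-|i]; last by rewrite /I ltn_ord.
  apply: eq_integral => w _; congr EFin; apply: eq_bigr => i _.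
  by rewrite tnth_mktuple /I ltn_ord.
elim: j => [_|j IHj jn].
  rewrite big_pred0// (eq_integral (cst 1%E)) => [|w _].
    by rewrite integral_cst// mul1e; exact: probability_setT.
  by rewrite /cst; congr EFin; rewrite /pr big1// => i _; rewrite tnth_mktuple.
pose j' := Ordinal jn.
rewrite (bigD1 j')/=; last by rewrite /I /=.
rewrite [X in (_ * X)%E](eq_bigl (I j)) => [|i]; last first.
  by rewrite /I ltnS [RHS]ltn_neqAle andbC.
rewrite -IHj ?(ltnW jn)//.
pose J : pred 'I_n := pred1 j'.
have -> : (\int[P]_w (f j' (W j' w))%:E = \int[P]_w (pr (m J w))%:E)%E.
  apply: eq_integral => w _; congr EFin; rewrite /pr (bigD1 j')//= big1.
    by rewrite mulr1 tnth_mktuple /J/= eqxx.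
  by move=> i ij; rewrite tnth_mktuple /J/= (negbTE ij).
rewrite muleC -split_int => [|i]; last first.
  by rewrite /I /J/= -val_eqE/= => ij; rewrite neq_ltn ij.
apply: eq_integral => w _; congr EFin; rewrite -big_split/=.
apply: eq_bigr => i _; rewrite !tnth_mktuple /I /J/= ltnS leq_eqVlt -val_eqE/=.
by case: ltngtP => //=; rewrite ?mulr1 ?mul1r.
Qed.

End IndependentFamilies.

(** * Exponential moments of quadratic forms *)

Section MeasurableMatrix.
Context {disp : measure_display} {T : measurableType disp} {R : realType}.

Lemma measurable_invr : measurable_fun [set: R] (@GRing.inv R).
Proof.
(* Away from 0 this is x * x^-2; at 0 the factor x gives the conventional value 0. *)
rewrite (_ : @GRing.inv R = fun x => x * expR (- ln (x ^+ 2))).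
  apply: measurable_funM => //; apply: measurableT_comp => //.
  by apply: measurableT_comp => //; apply: measurableT_comp => //;
    exact: measurable_funX.
apply/funext => x; have [->|x0] := eqVneq x 0; first by rewrite invr0 mul0r.
by rewrite expRN lnK ?posrE ?exprn_even_gt0// expr2 invfM mulrA divff// mul1r.
Qed.

Definition measurable_mx {m n : nat} (M : T -> 'M[R]_(m, n)) : Prop :=
  forall i j, measurable_fun setT (fun w => M w i j).

Lemma measurable_mx_cst {m n : nat} (A : 'M[R]_(m, n)) : measurable_mx (fun=> A).
Proof. by move=> i j; exact: measurable_cst. Qed.

Lemma measurable_mxD {m n : nat} (M N : T -> 'M[R]_(m, n)) :
  measurable_mx M -> measurable_mx N -> measurable_mx (fun w => M w + N w).
Proof.
move=> mM mN i j; under eq_fun do rewrite mxE; exact: measurable_funD.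
Qed.

Lemma measurable_mxN {m n : nat} (M : T -> 'M[R]_(m, n)) :
  measurable_mx M -> measurable_mx (fun w => - M w).
Proof.
by move=> mM i j; under eq_fun do rewrite mxE; exact: measurableT_comp.
Qed.

Lemma measurable_mxB {m n : nat} (M N : T -> 'M[R]_(m, n)) :
  measurable_mx M -> measurable_mx N -> measurable_mx (fun w => M w - N w).
Proof. by move=> mM mN; apply: measurable_mxD => //; exact: measurable_mxN. Qed.

Lemma measurable_mxZ {m n : nat} (f : T -> R) (M : T -> 'M[R]_(m, n)) :
  measurable_fun setT f -> measurable_mx M -> measurable_mx (fun w => f w *: M w).
Proof.
by move=> mf mM i j; under eq_fun do rewrite mxE; exact: measurable_funM.
Qed.

Lemma measurable_mxM {m n p : nat} (M : T -> 'M[R]_(m, n)) (N : T -> 'M[R]_(n, p)) :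
  measurable_mx M -> measurable_mx N -> measurable_mx (fun w => M w *m N w).
Proof.
move=> mM mN i j; under eq_fun do rewrite mxE.
by apply: measurable_sum => k; exact: measurable_funM.
Qed.

Lemma measurable_mx_tr {m n : nat} (M : T -> 'M[R]_(m, n)) :
  measurable_mx M -> measurable_mx (fun w => (M w)^T).
Proof. by move=> mM i j; under eq_fun do rewrite mxE; exact: mM. Qed.

Lemma measurable_mxsub {m n m' n' : nat} (f : 'I_m' -> 'I_m) (g : 'I_n' -> 'I_n)
    (M : T -> 'M[R]_(m, n)) :
  measurable_mx M -> measurable_mx (fun w => mxsub f g (M w)).
Proof. by move=> mM i j; under eq_fun do rewrite mxE; exact: mM. Qed.

Lemma measurable_det {n : nat} (M : T -> 'M[R]_n) :
  measurable_mx M -> measurable_fun setT (fun w => \det (M w)).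
Proof.
move=> mM; rewrite /determinant; apply: measurable_sum => s.
by apply: measurable_funM => //; apply: measurable_prod => i _; exact: mM.
Qed.

Lemma measurable_invmx {n : nat} (M : T -> 'M[R]_n) :
  measurable_mx M -> measurable_mx (fun w => invmx (M w)).
Proof.
move=> mM i j; have mdet := measurable_det mM.
have madj : measurable_mx (fun w => \adj (M w)).
  move=> {}i {}j; under eq_fun do rewrite mxE /cofactor.
  apply: measurable_funM => //; apply: measurable_det => k l.
  by under eq_fun do rewrite !mxE; exact: mM.
(* [invmx] returns a singular matrix unchanged, hence the first branch. *)
rewrite (_ : (fun w => _) =
  (fun w => if \det (M w) == 0 then M w i j else (\det (M w))^-1 * \adj (M w) i j)).
  apply: measurable_fun_ifT => //; first exact: measurable_fun_eqr.
  by apply: measurable_funM => //; exact: (measurableT_comp measurable_invr).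
apply/funext => w; rewrite /invmx unitmxE unitfE.
by case: eqP => //= _; rewrite mxE.
Qed.

End MeasurableMatrix.

Section GaussianVectors.
Context {disp : measure_display} {T : measurableType disp} {R : realType}
  (P : probability T R).

Lemma integral_normal_law (s2 : R) (Z : {RV P >-> R}) (f : R -> \bar R) :
  has_normal_law 0 s2 Z -> measurable_fun setT f -> (forall x, 0 <= f x)%E ->
  (\int[P]_w f (Z w) = \int[gauss (Num.sqrt s2)]_x f x)%E.
Proof.
move=> Zlaw mf f0; rewrite -(ge0_integral_distribution Z mf f0).
by apply: eq_measure_integral => A mA _; exact: Zlaw.
Qed.

(* Integrating out one coordinate at a time keeps the exponential quadratic, with
   the coefficient s replaced by s / (1 - 2 s v_k^2). *)
Lemma integral_expR_sqr_linear (d : nat) (Z : 'I_d -> {RV P >-> R}) (v : 'I_d -> R)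
    (s : R) :
  (forall k, has_normal_law 0 1 (Z k)) -> mutually_independent Z ->
  2 * s * (\sum_k v k ^+ 2) < 1 ->
  (\int[P]_w (expR (s * (\sum_k v k * Z k w) ^+ 2))%:E =
   (Num.sqrt (1 - 2 * s * \sum_k v k ^+ 2))^-1%:E)%E.
Proof.
move=> Zlaw mi; pose I (j : nat) : pred 'I_d := fun i => (i < j)%N.
suff H j : (j <= d)%N -> forall s, 2 * s * (\sum_(k | I j k) v k ^+ 2) < 1 ->
    (\int[P]_w (expR (s * (\sum_(k | I j k) v k * Z k w) ^+ 2))%:E =
     (Num.sqrt (1 - 2 * s * \sum_(k | I j k) v k ^+ 2))^-1%:E)%E.
  have big_I (F : 'I_d -> R) : \sum_(k | I d k) F k = \sum_k F k.
    by apply: eq_bigl => k; rewrite /I ltn_ord.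
  move=> sv; have := H d (leqnn d) s; rewrite big_I => /(_ sv) <-.
  by apply: eq_integral => w _; rewrite big_I.
elim: j => [_ {}s _|j IHj jd {}s sv].
  rewrite big_pred0// mulr0 subr0 sqrtr1 invr1.
  under eq_integral do rewrite big_pred0// expr0n mulr0 expR0.
  by rewrite integral_cst// mul1e; exact: probability_setT.
pose j' := Ordinal jd.
have bigS (F : 'I_d -> R) : \sum_(k | I j.+1 k) F k = \sum_(k | I j k) F k + F j'.
  rewrite (bigD1 j')/=; last by rewrite /I/=.
  rewrite addrC; congr (_ + _); apply: eq_bigl => k.
  by rewrite /I ltnS [RHS]ltn_neqAle andbC.
have mZ : measurable_fun setT (Z j') by [].
pose D := 1 - 2 * s * v j' ^+ 2.
have S0 : 0 <= \sum_(k | I j k) v k ^+ 2 by apply: sumr_ge0 => k _; exact: sqr_ge0.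
have v0 : 0 <= v j' ^+ 2 by exact: sqr_ge0.
move: sv; rewrite bigS => sv.
(* Both signs of [s] occur: the lower tail of the design takes [s] negative, and then D >= 1. *)
have D0 : 0 < D.
  rewrite /D subr_gt0; have [s0|s0] := leP 0 s; last by nra.
  by apply: le_lt_trans sv; nra.
pose sm (t : d.-tuple R) := \sum_(k < d) tnth t k.
have msm : measurable_fun setT sm.
  by apply: measurable_sum => k; exact: measurable_tnth.
pose U w := [tuple if I j k then v k * Z k w else 0 | k < d].
pose V w := [tuple if k == j' then v k * Z k w else 0 | k < d].
have smU w : sm (U w) = \sum_(k | I j k) v k * Z k w.
  rewrite /sm [RHS]big_mkcond/=; apply: eq_bigr => k _; by rewrite tnth_mktuple.
have smV w : sm (V w) = v j' * Z j' w.
  rewrite /sm (bigD1 j')//= big1 ?addr0 ?tnth_mktuple ?eqxx// => k kj.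
  by rewrite tnth_mktuple (negbTE kj).
pose F (x : d.-tuple R * d.-tuple R) := (expR (s * (sm x.1 + sm x.2) ^+ 2))%:E.
have mF : measurable_fun setT F.
  apply/measurable_EFinP; apply: measurableT_comp => //.
  apply: measurable_funM => //; apply: measurable_funX.
  apply: measurable_funD; first exact: (measurableT_comp msm measurable_fst).
  exact: (measurableT_comp msm measurable_snd).
transitivity (\int[P]_w F (U w, V w))%E.
  by apply: eq_integral => w _; rewrite /F/= smU smV bigS.
rewrite (@integral_indep_mask _ _ _ P _ _ d Z (fun k x => v k * x)
  (fun k x => v k * x) 0 (I j) (pred1 j'))//; last 4 first.
- by move=> i; rewrite /I/= -val_eqE/= => ij; rewrite neq_ltn ij.
- by move=> i; exact: measurable_funM.
- by move=> i; exact: measurable_funM.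
- by move=> x; rewrite /F lee_fin expR_ge0.
transitivity (\int[P]_w ((Num.sqrt D)^-1%:E *
    (expR (s / D * (\sum_(k | I j k) v k * Z k w) ^+ 2))%:E))%E.
  apply: eq_integral => w _; set a := \sum_(k | I j k) v k * Z k w.
  transitivity (\int[P]_w' ((expR (s * a ^+ 2))%:E *
      (expR (s * v j' ^+ 2 * (Z j' w') ^+ 2 + 2 * s * a * v j' * Z j' w'))%:E))%E.
    apply: eq_integral => w' _; rewrite -EFinM -expRD /F/=; congr (expR _)%:E.
    have := smV w'; rewrite /V => ->; have := smU w; rewrite /U => ->.
    by rewrite -/a; ring.
  have mE : measurable_fun setT (fun x : R =>
      (expR (s * v j' ^+ 2 * x ^+ 2 + 2 * s * a * v j' * x))%:E).
    apply/measurable_EFinP; apply: measurableT_comp => //.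
    by apply: measurable_funD; apply: measurable_funM => //; exact: measurable_funX.
  rewrite ge0_integralZl ?lee_fin ?expR_ge0//; last exact: (measurableT_comp mE mZ).
  rewrite (integral_normal_law (Zlaw j') mE)//.
  have sD : 2 * (s * v j' ^+ 2) * 1 ^+ 2 < 1.
    by rewrite expr1n mulr1 mulrA -subr_gt0.
  rewrite sqrtr1 integral_gauss_quad ?oner_eq0//.
  rewrite expr1n !mulr1 -[1 - _]/(1 - 2 * (s * v j' ^+ 2)) [2 * (s * _)]mulrA -/D.
  rewrite -!EFinM mulrCA -expRD; congr (_ * expR _)%:E.
  by rewrite /D; field; rewrite -/D gt_eqF.
have mG : measurable_fun setT
    (fun w => (expR (s / D * (\sum_(k | I j k) v k * Z k w) ^+ 2))%:E).
  apply/measurable_EFinP; apply: measurableT_comp => //.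
  apply: measurable_funM => //; apply: measurable_funX.
  under eq_fun do rewrite -smU; apply: (measurableT_comp msm).
  apply: (measurable_fun_mktuple (f := fun k w => if I j k then v k * Z k w else 0)).
  by move=> k; case: (I j k) => //; exact: measurable_funM.
rewrite ge0_integralZl//.
(* The factors telescope: D times the left side is 1 - 2 s times the longer sum, so the two square
   roots merge into one. *)
have sDE : 1 - 2 * (s / D) * (\sum_(k | I j k) v k ^+ 2) =
    (1 - 2 * s * (\sum_(k | I j k) v k ^+ 2 + v j' ^+ 2)) / D.
  by rewrite /D; field; rewrite -/D gt_eqF.
rewrite IHj ?(ltnW jd)//; last first.
  by rewrite -subr_gt0 sDE divr_gt0// subr_gt0.
rewrite -EFinM -invfM -sqrtrM ?(ltW D0)// sDE; congr (Num.sqrt _)^-1%:E.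
by rewrite mulrC divfK// gt_eqF.
Qed.

(** For a symmetric idempotent, the trace is that of Q^T Q, the sum of the squared entries. This
    starts the induction on the rank of a projection, measured by its trace. *)
Lemma sym_idem_trace0 {n : nat} (Q : 'M[R]_n) :
  Q^T = Q -> Q *m Q = Q -> \tr Q = 0 -> Q = 0.
Proof.
move=> Qs Qi tr0; have : \sum_i \sum_j Q i j ^+ 2 = 0.
  transitivity (\tr (Q^T *m Q)); last by rewrite Qs Qi.
  rewrite /mxtrace exchange_big/=.
  by apply: eq_bigr => j _; rewrite mxE; apply: eq_bigr => i _; rewrite mxE expr2.
move=> /eqP; rewrite psumr_eq0; last by move=> i _; apply: sumr_ge0 => j _; exact: sqr_ge0.
move=> /allP Q0; apply/matrixP => i j; rewrite mxE.
have := Q0 i (mem_index_enum _) => /=; rewrite psumr_eq0;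
  last by move=> ? _; exact: sqr_ge0.
by move=> /allP/(_ j (mem_index_enum _))/=; rewrite sqrf_eq0 => /eqP.
Qed.

Lemma trmx11 (A : 'M[R]_1) : A^T = A.
Proof. by apply/matrixP => i j; rewrite mxE (ord1 i) (ord1 j). Qed.

(* The factor exp(lam <u, e>^2) is linearized as the integral of
   exp(sqrt(2 lam) t <u, e>) against the standard normal law of t, which peels one
   unit vector u off the range of Q. *)
Lemma integral_expR_proj (n l : nat) (e : T -> 'cV[R]_n) (s lam : R) :
  measurable_mx e -> 0 <= lam -> 2 * lam * s ^+ 2 < 1 ->
  (forall h : 'cV[R]_n, \int[P]_w (expR ((h^T *m e w) ord0 ord0))%:E =
     (expR (s ^+ 2 / 2 * (h^T *m h) ord0 ord0))%:E)%E ->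
  forall (Q : 'M[R]_n) (h : 'cV[R]_n),
  Q^T = Q -> Q *m Q = Q -> \tr Q = l%:R -> Q *m h = 0 ->
  (\int[P]_w (expR (lam * ((e w)^T *m Q *m e w) ord0 ord0 +
                    (h^T *m e w) ord0 ord0))%:E =
   ((Num.sqrt (1 - 2 * lam * s ^+ 2))^-1 ^+ l *
    expR (s ^+ 2 / 2 * (h^T *m h) ord0 ord0))%:E)%E.
Proof.
move=> me lam0 lams He; elim: l => [|l IHl] Q h Qs Qi Qtr Qh.
  have -> : Q = 0 by exact: sym_idem_trace0.
  rewrite expr0 mul1r -(He h); apply: eq_integral => w _.
  by rewrite mulmx0 mul0mx mxE mulr0 add0r.
have Q0 : Q != 0.
  by apply/eqP => Q0; move: Qtr; rewrite Q0 mxtrace0 => /esym/eqP; rewrite pnatr_eq0.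
have [i [j Qij]] : exists i j, Q i j != 0.
  apply: contrapT => nQ; move/eqP: Q0; apply; apply/matrixP => i j; rewrite mxE.
  by apply/eqP; apply: contrapT => Qij; apply: nQ; exists i, j; apply/negP.
(* A nonzero column of [Q] is fixed by [Q]; normalized, it is the unit vector to be split off. *)
pose q := col j Q; pose c2 := (q^T *m q) ord0 ord0.
have c20 : 0 < c2.
  rewrite /c2 mxE (bigD1 i)//= ltr_pwDl//.
    by rewrite !mxE -expr2 exprn_even_gt0.
  by apply: sumr_ge0 => k _; rewrite !mxE -expr2 sqr_ge0.
pose u := (Num.sqrt c2)^-1 *: q.
have Qu : Q *m u = u by rewrite -scalemxAr /u /q colE mulmxA Qi.
have uu : u^T *m u = 1%:M.
  have -> : u^T = (Num.sqrt c2)^-1 *: q^T by rewrite /u linearZ.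
  rewrite /u -scalemxAl -scalemxAr scalerA -invfM -expr2 sqr_sqrtr ?ltW//.
  by rewrite [q^T *m q]mx11_scalar -/c2 scale_scalar_mx mulVf ?gt_eqF.
have uQ : u^T *m Q = u^T by rewrite -[in LHS]Qs -trmx_mul Qu.
have uh : u^T *m h = 0 by rewrite -uQ -mulmxA Qh mulmx0.
have hu : h^T *m u = 0 by rewrite -[LHS]trmxK trmx_mul trmxK uh trmx0.
pose Q' := Q - u *m u^T.
have Q's : Q'^T = Q' by rewrite /Q' linearB/= Qs trmx_mul trmxK.
have Q'i : Q' *m Q' = Q'.
  rewrite /Q' mulmxBl !mulmxBr Qi !mulmxA Qu -[u *m u^T *m Q]mulmxA uQ.
  by rewrite -[u *m u^T *m u]mulmxA uu mulmx1 subrr subr0.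
have Q'tr : \tr Q' = l%:R.
  by rewrite /Q' linearB/= Qtr mxtrace_mulC uu mxtrace1 -addn1 natrD addrK.
pose c := Num.sqrt (2 * lam).
have c2E : c ^+ 2 = 2 * lam by rewrite sqr_sqrtr// mulr_ge0.
(* Since [Q'] kills both [h] and [u], the induction hypothesis applies to the shifted linear term
   for every [t]. *)
have Q'h t : Q' *m (h + (c * t) *: u) = 0.
  rewrite mulmxDr -scalemxAr /Q' !mulmxBl Qh Qu -!mulmxA uh uu mulmx1 mulmx0.
  by rewrite !subrr scaler0 addr0.
pose g := gauss (1 : R).
have Q'E : Q' = Q - u *m u^T by [].
clearbody Q' u c.
have mexp a b : measurable_fun setT (fun t : R => (expR (a * t ^+ 2 + b * t))%:E).
  apply/measurable_EFinP; apply: measurableT_comp => //.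
  by apply: measurable_funD; apply: measurable_funM => //; exact: measurable_funX.
pose F (x : T * R) := (expR (lam * ((e x.1)^T *m Q' *m e x.1) ord0 ord0 +
  ((h + (c * x.2) *: u)^T *m e x.1) ord0 ord0))%:E.
have mF : measurable_fun setT F.
  apply/measurable_EFinP; apply: measurableT_comp => //.
  have me1 : measurable_mx (fun x : T * R => e x.1).
    by move=> k m; exact: (measurableT_comp (me k m) measurable_fst).
  apply: measurable_funD.
    apply: measurable_funM => //.
    apply: measurable_mxM => //; apply: measurable_mxM => //.
    exact: measurable_mx_tr.
  apply: measurable_mxM => //; apply: measurable_mx_tr; apply: measurable_mxD.
    exact: measurable_mx_cst.
  apply: measurable_mxZ; last exact: measurable_mx_cst.
  by apply: measurable_funM => //; exact: measurable_snd.
have F0 x : (0 <= F x)%E by rewrite /F lee_fin expR_ge0.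
transitivity (\int[P]_w \int[g]_t F (w, t))%E.
  apply: eq_integral => w _; set y := (u^T *m e w) ord0 ord0.
  transitivity (\int[g]_t ((expR (lam * ((e w)^T *m Q' *m e w) ord0 ord0 +
      (h^T *m e w) ord0 ord0))%:E * (expR (0 * t ^+ 2 + c * y * t))%:E))%E; last first.
    apply: eq_integral => t _; rewrite -EFinM -expRD /F/=; congr (expR _)%:E.
    have -> : ((h + (c * t) *: u)^T *m e w) ord0 ord0 =
        (h^T *m e w) ord0 ord0 + c * t * y.
      by rewrite linearD/= linearZ/= mulmxDl -scalemxAl mxE [X in _ + X]mxE.
    by ring.
  rewrite ge0_integralZl ?lee_fin ?expR_ge0//.
  have c01 : 2 * 0 * (1 : R) ^+ 2 < 1 by rewrite mulr0 mul0r.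
  rewrite integral_gauss_quad ?oner_eq0//.
  rewrite mulr0 mul0r subr0 sqrtr1 invr1 mul1r -EFinM -expRD; congr (expR _)%:E.
  have -> : ((e w)^T *m Q *m e w) ord0 ord0 =
      ((e w)^T *m Q' *m e w) ord0 ord0 + y ^+ 2.
    rewrite Q'E mulmxBr mulmxBl [in RHS]mxE [X in _ + X + _]mxE.
    rewrite [X in _ = _ - X + _](_ : _ = y ^+ 2) ?subrK//.
    have -> : (e w)^T *m (u *m u^T) *m e w = (u^T *m e w)^T *m (u^T *m e w).
      by rewrite trmx_mul trmxK !mulmxA.
    by rewrite trmx11 [u^T *m e w]mx11_scalar -scalar_mxM mxE eqxx mulr1n -/y expr2.
  by rewrite !expr1n !mulr1 exprMn c2E; field.
(* With [t] outermost, the integral over [w] is the case of rank [l]; what remains in [t] is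
   Gaussian and yields one more factor [K]. *)
rewrite fubini_tonelli//.
pose K := (Num.sqrt (1 - 2 * lam * s ^+ 2))^-1.
transitivity (\int[g]_t ((K ^+ l * expR (s ^+ 2 / 2 * (h^T *m h) ord0 ord0))%:E *
   (expR (s ^+ 2 * lam * t ^+ 2 + 0 * t))%:E))%E.
  apply: eq_integral => t _; rewrite /F/= IHl//.
  rewrite -EFinM; congr EFin; rewrite -[RHS]mulrA -expRD; congr (_ * expR _).
  have -> : ((h + (c * t) *: u)^T *m (h + (c * t) *: u)) ord0 ord0 =
      (h^T *m h) ord0 ord0 + (c * t) ^+ 2.
    have -> : (h + (c * t) *: u)^T = h^T + (c * t) *: u^T by rewrite linearD linearZ.
    rewrite mulmxDl !mulmxDr -!scalemxAl -!scalemxAr uu uh hu.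
    rewrite scaler0 addr0 add0r scalerA mxE [X in _ + X]mxE [X in _ * X]mxE.
    by rewrite eqxx mulr1n mulr1 expr2.
  by rewrite mul0r addr0 exprMn c2E; field.
rewrite ge0_integralZl ?lee_fin//.
have c01 : 2 * (s ^+ 2 * lam) * (1 : R) ^+ 2 < 1.
  by rewrite expr1n mulr1 [s ^+ 2 * _]mulrC mulrA.
rewrite integral_gauss_quad ?oner_eq0//.
  rewrite expr0n/= mul0r mul0r expR0 mulr1 expr1n mulr1 [s ^+ 2 * lam]mulrC mulrA.
  by rewrite -EFinM -/K [in RHS]exprSr; congr EFin; rewrite mulrAC.
by rewrite mulr_ge0 ?expR_ge0// exprn_ge0// invr_ge0 sqrtr_ge0.
Qed.

End GaussianVectors.

(** * Quadratic forms *)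

Section BilinearForms.
Context {R : realType}.

Definition bilin {m n : nat} (A : 'M[R]_(m, n)) (u : 'cV[R]_m) (v : 'cV[R]_n) : R :=
  (u^T *m A *m v) ord0 ord0.

Lemma bilinDl {m n : nat} (A : 'M[R]_(m, n)) u1 u2 v :
  bilin A (u1 + u2) v = bilin A u1 v + bilin A u2 v.
Proof. by rewrite /bilin linearD/= !mulmxDl mxE. Qed.

Lemma bilinDr {m n : nat} (A : 'M[R]_(m, n)) u v1 v2 :
  bilin A u (v1 + v2) = bilin A u v1 + bilin A u v2.
Proof. by rewrite /bilin mulmxDr mxE. Qed.

Lemma bilinZl {m n : nat} (A : 'M[R]_(m, n)) c u v :
  bilin A (c *: u) v = c * bilin A u v.
Proof. by rewrite /bilin linearZ/= -!scalemxAl mxE. Qed.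

Lemma bilinZr {m n : nat} (A : 'M[R]_(m, n)) c u v :
  bilin A u (c *: v) = c * bilin A u v.
Proof. by rewrite /bilin -scalemxAr mxE. Qed.

Lemma bilinNl {m n : nat} (A : 'M[R]_(m, n)) u v : bilin A (- u) v = - bilin A u v.
Proof. by rewrite -scaleN1r bilinZl mulN1r. Qed.

Lemma bilinNr {m n : nat} (A : 'M[R]_(m, n)) u v : bilin A u (- v) = - bilin A u v.
Proof. by rewrite -scaleN1r bilinZr mulN1r. Qed.

Lemma bilin0l {m n : nat} (A : 'M[R]_(m, n)) v : bilin A 0 v = 0.
Proof. by rewrite -(scale0r 0) bilinZl mul0r. Qed.

Lemma bilin_tr {m n : nat} (A : 'M[R]_(m, n)) u v : bilin A u v = bilin A^T v u.
Proof.
rewrite /bilin; have <- : (u^T *m A *m v)^T = v^T *m A^T *m u.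
  by rewrite !trmx_mul trmxK mulmxA.
by rewrite [RHS]mxE.
Qed.

Lemma bilin_sym {n : nat} (A : 'M[R]_n) u v : A^T = A -> bilin A u v = bilin A v u.
Proof. by move=> As; rewrite bilin_tr As. Qed.

Lemma bilin_mul {m n p q : nat} (A : 'M[R]_(m, n)) (B : 'M[R]_(m, p))
    (C : 'M[R]_(n, q)) u v :
  bilin A (B *m u) (C *m v) = bilin (B^T *m A *m C) u v.
Proof. by rewrite /bilin trmx_mul !mulmxA. Qed.

Lemma bilin_eq {m n : nat} (A : 'M[R]_(m, n)) u v :
  bilin A u v = \sum_i \sum_j A i j * u i ord0 * v j ord0.
Proof.
rewrite /bilin mxE exchange_big/=; apply: eq_bigr => j _.
by rewrite mxE big_distrl/=; apply: eq_bigr => i _; rewrite mxE [_ * A i j]mulrC.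
Qed.

Lemma sqnorm_bilin {n : nat} (u : 'cV[R]_n) : sqnorm u = bilin 1%:M u u.
Proof.
by rewrite /bilin mulmx1 mxE; apply: eq_bigr => i _; rewrite mxE expr2.
Qed.

Lemma sqnorm_mul {m n : nat} (A : 'M[R]_(m, n)) u :
  sqnorm (A *m u) = bilin (A^T *m A) u u.
Proof. by rewrite sqnorm_bilin bilin_mul mulmx1. Qed.

Lemma sqnorm_ge0 {n : nat} (u : 'cV[R]_n) : 0 <= sqnorm u.
Proof. by apply: sumr_ge0 => i _; exact: sqr_ge0. Qed.

Lemma sqnorm_eq0 {n : nat} (u : 'cV[R]_n) : sqnorm u = 0 -> u = 0.
Proof.
move=> /eqP; rewrite psumr_eq0; last by move=> i _; exact: sqr_ge0.
move=> /allP u0; apply/matrixP => i j; rewrite (ord1 j) mxE.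
by have /= := u0 i (mem_index_enum _); rewrite sqrf_eq0 => /eqP.
Qed.

Lemma sqnorm0 {n : nat} : sqnorm (0 : 'cV[R]_n) = 0.
Proof. by rewrite sqnorm_bilin bilin0l. Qed.

Lemma sqnorm_gt0 {n : nat} (u : 'cV[R]_n) : u != 0 -> 0 < sqnorm u.
Proof.
move=> u0; rewrite lt_def sqnorm_ge0 andbT; apply/eqP => /sqnorm_eq0 u00.
by rewrite u00 eqxx in u0.
Qed.

Lemma sqnormZ {n : nat} c (u : 'cV[R]_n) : sqnorm (c *: u) = c ^+ 2 * sqnorm u.
Proof. by rewrite !sqnorm_bilin bilinZl bilinZr mulrA. Qed.

Lemma sqnormD {n : nat} (u v : 'cV[R]_n) :
  sqnorm (u + v) = sqnorm u + 2 * bilin 1%:M u v + sqnorm v.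
Proof.
rewrite !sqnorm_bilin bilinDl !bilinDr (bilin_sym v u) ?trmx1//; ring.
Qed.

Definition psd {n : nat} (A : 'M[R]_n) : Prop := forall u, 0 <= bilin A u u.

Lemma psd1 {n : nat} : psd (1%:M : 'M[R]_n).
Proof. by move=> u; rewrite -sqnorm_bilin sqnorm_ge0. Qed.

Lemma posdef_psd {n : nat} (A : 'M[R]_n) : posdef A -> psd A.
Proof.
move=> [_ Apos] u; have [->|u0] := eqVneq u 0; first by rewrite bilin0l.
exact/ltW/Apos.
Qed.

Lemma psd_cauchy_schwarz {n : nat} (A : 'M[R]_n) u v : A^T = A -> psd A ->
  bilin A u v ^+ 2 <= bilin A u u * bilin A v v.
Proof.
move=> As Apsd; set a := bilin A u u; set b := bilin A u v; set c := bilin A v v.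
have c0 : 0 <= c by exact: Apsd.
have H t : 0 <= a - 2 * t * b + t ^+ 2 * c.
  have := Apsd (u - t *: v).
  rewrite bilinDl !bilinDr !bilinNl !bilinNr !bilinZl !bilinZr (bilin_sym v u As).
  by rewrite -/a -/b -/c; congr (0 <= _); ring.
have [c00|cn0] := eqVneq c 0.
  have [->|b0] := eqVneq b 0; first by rewrite expr0n mulr_ge0// Apsd.
  (* With c = 0 the form is affine in [t]; this [t] gives it the value -1 if b is not 0. *)
  have := H ((a + 1) / (2 * b)); rewrite c00 mulr0 addr0.
  have -> : a - 2 * ((a + 1) / (2 * b)) * b = - 1 by field.
  by rewrite oppr_ge0 ler10.
have cp : 0 < c by rewrite lt_neqAle eq_sym cn0.
have := H (b / c); have -> : a - 2 * (b / c) * b + (b / c) ^+ 2 * c = (a * c - b ^+ 2) / c.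
  by field.
by rewrite pmulr_lge0 ?invr_gt0// subr_ge0.
Qed.

Lemma bilin_le_sqnorm {n : nat} (A : 'M[R]_n) u :
  `|bilin A u u| <= (\sum_i \sum_j `|A i j|) * sqnorm u.
Proof.
rewrite bilin_eq big_distrl/=; apply: le_trans (ler_norm_sum _ _ _) _.
apply: ler_sum => i _; rewrite big_distrl/=; apply: le_trans (ler_norm_sum _ _ _) _.
apply: ler_sum => j _; rewrite !normrM -mulrA ler_wpM2l//.
have sq k : `|u k ord0| ^+ 2 <= sqnorm u.
  rewrite /sqnorm (bigD1 k)//= real_normK ?num_real// lerDl.
  by apply: sumr_ge0 => ? _; exact: sqr_ge0.
have := sq i; have := sq j; have := normr_ge0 (u i ord0); have := normr_ge0 (u j ord0).
nra.
Qed.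

Lemma unitmx_inj {n : nat} (A : 'M[R]_n) :
  (forall x : 'cV_n, A *m x = 0 -> x = 0) -> A \in unitmx.
Proof.
move=> Ainj; rewrite unitmxE unitfE -det_tr; apply/negP => /det0P[v v0 vA].
move/eqP: v0; apply; apply: trmx_inj; rewrite trmx0; apply: Ainj.
by rewrite -[A]trmxK -trmx_mul vA trmx0.
Qed.

(** Cauchy-Schwarz for the form of [A], applied to u and A^-1 u, gives |u|^4 <= (u^T A u)(u^T A^-1
    u), and the last factor is at most a constant times |u|^2. This stands in for the spectral
    theorem. *)
Lemma psd_unit_lb {n : nat} (A : 'M[R]_n) : A^T = A -> psd A -> A \in unitmx ->
  exists2 c : R, 0 < c & forall u, c * sqnorm u <= bilin A u u.
Proof.
move=> As Apsd Au; pose K := 1 + \sum_i \sum_j `|(invmx A) i j|.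
have K0 : 0 < K.
  by rewrite ltr_pwDl//; apply: sumr_ge0 => i _; apply: sumr_ge0 => j _.
exists K^-1; first by rewrite invr_gt0.
move=> u; have [->|u0] := eqVneq u 0; first by rewrite sqnorm0 mulr0 bilin0l.
have s0 := sqnorm_gt0 u0.
have CS := psd_cauchy_schwarz u (invmx A *m u) As Apsd.
have e1 : bilin A u (invmx A *m u) = sqnorm u.
  by rewrite sqnorm_bilin /bilin -mulmxA (mulmxA A) mulmxV// mul1mx mulmx1.
have e2 : bilin A (invmx A *m u) (invmx A *m u) = bilin (invmx A) u u.
  by rewrite bilin_mul -mulmxA mulmxV// mulmx1 trmx_inv As.
rewrite e1 e2 in CS.
have b1 : bilin (invmx A) u u <= K * sqnorm u.
  apply: le_trans (ler_norm _) _; apply: le_trans (bilin_le_sqnorm _ _) _.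
  by rewrite ler_wpM2r ?(ltW s0)// lerDr.
rewrite ler_pdivrMl//; have A0 := Apsd u.
have : sqnorm u ^+ 2 <= bilin A u u * (K * sqnorm u).
  by apply: le_trans CS _; rewrite ler_wpM2l.
by rewrite expr2 mulrA ler_pM2r// mulrC.
Qed.

(* The largest t such that A - t I is positive semidefinite is an eigenvalue of A
   since A - t I is singular there. *)
Lemma lambda_min_le {n : nat} (A : 'M[R]_n) (w : R) u : A^T = A ->
  w <= lambda_min A -> w * sqnorm u <= bilin A u u.
Proof.
case: n A u => [|n] A u As wA.
  by rewrite (flatmx0 u) sqnorm0 mulr0 bilin0l.
pose S := [set t : R | forall v : 'cV_n.+1, t * sqnorm v <= bilin A v v].
have S0 : S !=set0.
  exists (- \sum_i \sum_j `|A i j|) => v; rewrite mulNr.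
  have := bilin_le_sqnorm A v; rewrite ler_norml => /andP[H _].
  by rewrite -(lerN2 (bilin A v v)) opprK -lerN2 opprK.
have e0 : (delta_mx ord0 ord0 : 'cV[R]_n.+1) != 0.
  by apply/eqP => /matrixP/(_ ord0 ord0)/eqP; rewrite !mxE !eqxx oner_eq0.
have Sub : has_ubound S.
  pose e := delta_mx ord0 ord0 : 'cV[R]_n.+1.
  exists (bilin A e e / sqnorm e) => t /(_ e).
  by rewrite ler_pdivlMr// sqnorm_gt0.
pose m := sup S.
have mS : S m.
  move=> v; have [->|v0] := eqVneq v 0; first by rewrite sqnorm0 mulr0 bilin0l.
  rewrite -ler_pdivlMr ?sqnorm_gt0//; apply: ge_sup => // t /(_ v).
  by rewrite ler_pdivlMr// sqnorm_gt0.
pose B := A - m%:M.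
have BE v : bilin B v v = bilin A v v - m * sqnorm v.
  rewrite /bilin /B mulmxBr mulmxBl mxE [X in _ + X]mxE; congr (_ - _).
  by rewrite sqnorm_bilin /bilin mulmx1 mul_mx_scalar -scalemxAl mxE.
have Bs : B^T = B by rewrite /B linearB/= As tr_scalar_mx.
have Bpsd : psd B by move=> v; rewrite BE subr_ge0; exact: mS.
have eigm : eigenvalue A m.
  apply: contrapT => meig; have Bu : B \in unitmx.
    rewrite unitmxE unitfE; apply/negP => /det0P[v v0 vB]; apply: meig.
    apply/eigenvalueP; exists v => //; apply/eqP.
    by rewrite -subr_eq0 -mul_mx_scalar -mulmxBr vB.
  (* Were [B] invertible, its form would dominate c |v|^2, and m + c would be an element of [S]
     above its supremum. *)
  have [c c0 Bc] := psd_unit_lb Bs Bpsd Bu.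
  have : S (m + c).
    by move=> v; have := Bc v; rewrite BE mulrDl lerBrDl.
  by move/(ub_le_sup Sub); rewrite -/m gerDl leNgt c0.
apply: le_trans (mS u); rewrite ler_wpM2r ?sqnorm_ge0//.
(* The infimum is below its member [m] only if the eigenvalues are bounded below; testing [mS] on
   eigenvectors shows that [m] itself is a bound. *)
apply: le_trans wA _; apply: ge_inf => //; exists m => a /= /eigenvalueP[v vA v0].
have vt0 : v^T != 0 by rewrite -trmx0 (inj_eq trmx_inj).
have := mS v^T; rewrite /bilin trmxK vA -scalemxAl mxE.
have -> : (v *m v^T) ord0 ord0 = sqnorm v^T.
  by rewrite sqnorm_bilin /bilin trmxK mulmx1.
by rewrite ler_pM2r// sqnorm_gt0.
Qed.

Lemma posdef_unitmx {n : nat} (A : 'M[R]_n) : posdef A -> A \in unitmx.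
Proof.
move=> [_ Apos]; apply: unitmx_inj => x Ax; apply: contrapT => /eqP x0.
by have := Apos x x0; rewrite -mulmxA Ax mulmx0 mxE ltxx.
Qed.

Lemma posdef_congr {m n : nat} (A : 'M[R]_m) (B : 'M[R]_(m, n)) : posdef A ->
  (forall x : 'cV_n, B *m x = 0 -> x = 0) -> posdef (B^T *m A *m B).
Proof.
move=> [As Apos] Binj; split; first by rewrite !trmx_mul trmxK As mulmxA.
move=> u u0; rewrite -[X in 0 < X]/(bilin _ u u) -bilin_mul; apply: Apos.
by apply: contra u0 => /eqP/Binj ->.
Qed.

(** Cholesky reduction: block elimination with the pivot [g] leaves the Schur complement, to which
    induction applies. In the resulting basis the covariance is the identity, so rounding is
    insensitive to the conditioning of Sigma. *)
Lemma posdef_orthonormal {n : nat} (A : 'M[R]_n) : posdef A ->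
  exists B : 'M[R]_n, B^T *m A *m B = 1%:M.
Proof.
elim: n A => [|n IHn] A Apd; first by exists 1%:M; rewrite [LHS]flatmx0 [RHS]flatmx0.
have [As Apos] := Apd.
pose A1 : 'M[R]_(1 + n) := A.
pose g := A1 ord0 ord0; pose r := dlsubmx A1; pose A' := drsubmx A1.
have gE : ulsubmx A1 = g%:M.
  by rewrite [LHS]mx11_scalar; congr (_%:M); rewrite !mxE; congr (A1 _ _); apply: val_inj.
have A1s : A1^T = A1 := As.
have rE : ursubmx A1 = r^T by rewrite /r -[X in dlsubmx X]A1s -trmx_ursub trmxK.
have AE : A1 = block_mx g%:M r^T r A'.
  by rewrite -[LHS]submxK gE rE.
have g0 : 0 < g.
  pose e := delta_mx ord0 ord0 : 'cV[R]_n.+1.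
  have e0 : e != 0.
    by apply/eqP => /matrixP/(_ ord0 ord0)/eqP; rewrite !mxE !eqxx oner_eq0.
  by have := Apos e e0; rewrite /e trmx_delta -rowE -colE !mxE.
pose E : 'M[R]_(1 + n) := block_mx 1%:M (- g^-1 *: r^T) 0 1%:M.
pose A'' := A' - g^-1 *: (r *m r^T).
have EAE : E^T *m A1 *m E = block_mx g%:M 0 0 A''.
  rewrite /E AE tr_block_mx !trmx1 trmx0 linearZ/= trmxK !mulmx_block.
  rewrite !mul1mx !mul0mx !mulmx1 !mulmx0 !addr0 -!scalemxAl -!scalemxAr.
  rewrite !mul_scalar_mx !mul_mx_scalar !scalerA.
  rewrite mulNr mulVf ?gt_eqF// !scaleN1r !addNr mul0mx scaler0 add0r scaleNr addrC.
  by [].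
have A''pd : posdef A''.
  (* The Schur complement is the form of [A1] pulled back along an injective map, hence positive
     definite. *)
  have -> : A'' = (E *m col_mx 0 1%:M)^T *m A1 *m (E *m col_mx 0 1%:M).
    rewrite trmx_mul -!mulmxA (mulmxA A1) (mulmxA E^T) (mulmxA E^T) EAE.
    rewrite mul_block_col tr_col_mx mul_row_col !mulmx0 !mul0mx trmx0 trmx1 !mulmx1.
    by rewrite mul0mx !add0r mul1mx.
  apply: posdef_congr => // x.
  rewrite -mulmxA (mul_col_mx 0) mul0mx mul1mx /E mul_block_col !mulmx0 mul1mx !add0r.
  by move=> /(congr1 dsubmx); rewrite col_mxKd linear0.
have [B BA] := IHn _ A''pd.
pose D : 'M[R]_(1 + n) := block_mx (Num.sqrt g)^-1%:M 0 0 B.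
have DD : D^T *m (block_mx g%:M 0 0 A'' *m D) = 1%:M.
  rewrite /D tr_block_mx !trmx0 tr_scalar_mx !mulmx_block !mul0mx !mulmx0.
  rewrite !addr0 !add0r !mulmx0 [B^T *m (_ *m _)]mulmxA BA -!scalar_mxM.
  have -> : (Num.sqrt g)^-1 * (g * (Num.sqrt g)^-1) = 1.
    have s0 : Num.sqrt g != 0 by rewrite gt_eqF// sqrtr_gt0.
    by rewrite -[X in _ * (X * _)](sqr_sqrtr (ltW g0)); field.
  by rewrite -scalar_mx_block.
exists (E *m D); rewrite -[RHS]DD -EAE.
by rewrite [(E *m D)^T]trmx_mul -!mulmxA.
Qed.

End BilinearForms.

(** * Column selection and the signal carried by missing indices *)

Section Selection.
Context {R : realType} {d : nat}.
Implicit Types S : {set 'I_d}.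

(** As a 0/1 matrix, selection turns every submatrix into a matrix product; the transpose restricts
    a vector to [S], and [sel S] itself extends by 0. *)
Definition sel S : 'M[R]_(d, #|S|) := subset_cols 1%:M S.

Lemma selE S i (j : 'I_#|S|) : sel S i j = (i == enum_val j)%:R.
Proof. by rewrite !mxE. Qed.

Lemma subset_cols_sel {n : nat} (X : 'M[R]_(n, d)) S : subset_cols X S = X *m sel S.
Proof.
apply/matrixP => i j; rewrite mxE [RHS]mxE (bigD1 (enum_val j))//= selE eqxx mulr1.
by rewrite big1 ?addr0// => k kj; rewrite selE (negbTE kj) mulr0.
Qed.

Lemma tr_selM {m : nat} (A : 'M[R]_(d, m)) S i j : ((sel S)^T *m A) i j = A (enum_val i) j.
Proof.
rewrite mxE (bigD1 (enum_val i))//= mxE selE eqxx mul1r.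
by rewrite big1 ?addr0// => k ki; rewrite mxE selE (negbTE ki) mul0r.
Qed.

Lemma subset_mx_sel (A : 'M[R]_d) S1 S2 :
  subset_mx A S1 S2 = (sel S1)^T *m A *m sel S2.
Proof.
by apply/matrixP => i j; rewrite -subset_cols_sel [RHS]mxE tr_selM mxE.
Qed.

Lemma selM_out S (a : 'cV[R]_#|S|) i : i \notin S -> (sel S *m a) i ord0 = 0.
Proof.
move=> iS; rewrite mxE big1// => j _; rewrite selE.
by case: eqP => [ij|]; rewrite ?mul0r//; rewrite ij enum_valP in iS.
Qed.

Lemma tr_sel_sel S : (sel S)^T *m sel S = 1%:M.
Proof.
by apply/matrixP => i j; rewrite tr_selM selE mxE (inj_eq enum_val_inj).
Qed.

Lemma sel_inj S (a : 'cV[R]_#|S|) : sel S *m a = 0 -> a = 0.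
Proof. by move=> Sa; rewrite -[a]mul1mx -tr_sel_sel -mulmxA Sa mulmx0. Qed.

Lemma sel_tr_selM {m : nat} (A : 'M[R]_(d, m)) S i j :
  (sel S *m ((sel S)^T *m A)) i j = if i \in S then A i j else 0.
Proof.
rewrite mxE; case: ifPn => iS; last first.
  rewrite big1// => k _; rewrite selE; case: eqP => [ik|]; rewrite ?mul0r//.
  by rewrite ik enum_valP in iS.
rewrite (bigD1 (enum_rank_in iS i))//= big1 => [|k ki].
  by rewrite tr_selM selE enum_rankK_in// eqxx mul1r addr0.
rewrite selE; case: eqP => [ik|]; rewrite ?mul0r//.
by case/eqP: ki; apply: enum_val_inj; rewrite enum_rankK_in.
Qed.

Lemma sel_supported S (u : 'cV[R]_d) : (forall j, j \notin S -> u j ord0 = 0) ->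
  sel S *m ((sel S)^T *m u) = u.
Proof.
move=> uS; apply/matrixP => i j; rewrite sel_tr_selM (ord1 j).
by case: ifPn => // /uS ->.
Qed.

Lemma sel_subset S1 S2 : S1 \subset S2 -> sel S2 *m ((sel S2)^T *m sel S1) = sel S1.
Proof.
move=> S12; apply/matrixP => i j; rewrite sel_tr_selM; case: ifPn => // iS2.
rewrite selE; case: eqP => // ij; case/negP: iS2; rewrite ij.
by apply: (fintype.subsetP S12); exact: enum_valP.
Qed.

(* Completing the square: the conditional covariance is the quadratic form of Sigma
   minimized over the coordinates in S. *)
Lemma cond_cov_le (Sigma : 'M[R]_d) S T a b : posdef Sigma ->
  bilin (cond_cov Sigma T S) b b <=
  bilin Sigma (sel (T :\: S) *m b + sel S *m a) (sel (T :\: S) *m b + sel S *m a).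
Proof.
move=> Spd; have [Ss _] := Spd.
set V := sel (T :\: S); set W := sel S; rewrite /cond_cov !subset_mx_sel -/V -/W.
set G := W^T *m Sigma *m W.
have Gpd : posdef G by apply: posdef_congr => // x; exact: sel_inj.
have Gu := posdef_unitmx Gpd.
pose K := invmx G *m (W^T *m Sigma *m V).
(* [w] is what remains of [V *m b] after regression on the coordinates in [S]: it is
   Sigma-orthogonal to all vectors supported on [S], and its form is the conditional covariance. *)
pose w := V *m b - W *m (K *m b).
have Ww : W^T *m Sigma *m w = 0.
  rewrite /w mulmxBr !mulmxA -/G -(mulmxA G) -/K.
  by rewrite /K !mulmxA mulmxV// mul1mx subrr.
have wW x : bilin Sigma w (W *m x) = 0.
  rewrite bilin_tr Ss /bilin trmx_mul -!mulmxA (mulmxA W^T) Ww mulmx0 mxE //.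
have -> : V *m b + W *m a = w + W *m (a + K *m b).
  by rewrite /w mulmxDr [W *m a + _]addrC addrA subrK.
have wE : w = V *m b - W *m (K *m b) by [].
clearbody w; rewrite bilinDl !bilinDr wW (bilin_sym _ w Ss) wW addr0 add0r.
have -> : bilin Sigma w w = bilin (V^T *m Sigma *m V -
    V^T *m Sigma *m W *m invmx G *m (W^T *m Sigma *m V)) b b.
  rewrite {2}wE bilinDr bilinNr wW subr0 bilin_tr Ss.
  rewrite /bilin trmx_mul -!mulmxA; congr ((b^T *m _) ord0 ord0).
  by rewrite wE !mulmxBl !mulmxBr /K !mulmxA.
by rewrite lerDl; apply: posdef_psd.
Qed.

(** Modulo vectors supported on [S], [beta] is its restriction to the missing indices. Each of these
    contributes at least beta_min^2 to the squared norm, and the smallest eigenvalue of the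
    conditional covariance supplies omega. *)
Lemma signal_lower_bound (sbar : nat) (beta_min omega : R) (beta : 'cV[R]_d)
    (Sigma : 'M[R]_d) S (a : 'cV[R]_#|S|) :
  0 < beta_min -> 0 < omega ->
  Theta sbar beta_min beta -> Omega sbar omega Sigma -> (#|S| <= sbar)%N ->
  omega * beta_min ^+ 2 * #|supp beta :\: S|%:R <=
  bilin Sigma (beta - sel S *m a) (beta - sel S *m a).
Proof.
move=> bm0 om0 [bs bmin] [Spd Som] Ssbar; set T := supp beta.
(* [Omega] speaks only of sets [T] not contained in [S]; otherwise no index is missing and the left
   side is 0. *)
have [TS|TS] := boolP (T \subset S).
  move: TS; rewrite -finset.setD_eq0 => /eqP ->; rewrite cards0 mulr0.
  exact: (posdef_psd Spd).
pose b := (sel (T :\: S))^T *m beta.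
have betaE : beta = sel (T :\: S) *m b + sel S *m ((sel S)^T *m beta).
  apply/matrixP => i j; rewrite [RHS]mxE !sel_tr_selM (ord1 j) finset.in_setD.
  have [iS|iS]/= := boolP (i \in S); first by rewrite add0r.
  rewrite addr0; case: ifPn => //; rewrite inE negbK => /eqP //.
rewrite [in X in _ <= X]betaE -addrA -mulmxBr.
apply: le_trans (cond_cov_le _ _ Spd).
have [Ss _] := Spd; have cs : (cond_cov Sigma T S)^T = cond_cov Sigma T S.
  rewrite /cond_cov !subset_mx_sel linearB/= !trmx_mul !trmxK trmx_inv.
  by rewrite !trmx_mul !trmxK Ss !mulmxA.
apply: le_trans (lambda_min_le b cs (Som T S bs Ssbar TS)).
rewrite -mulrA ler_pM2l//.
have -> : beta_min ^+ 2 * #|T :\: S|%:R = \sum_(i < #|T :\: S|) beta_min ^+ 2.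
  by rewrite sumr_const card_ord mulr_natr.
apply: ler_sum => j _; rewrite tr_selM -[X in _ <= X]real_normK ?num_real//.
rewrite lerXn2r ?nnegrE ?(ltW bm0)// bmin//.
by have := enum_valP j; rewrite finset.in_setD => /andP[].
Qed.

End Selection.

(** * Projections and scores *)

Section Projections.
Context {R : realType}.

Definition proj {n d : nat} (X : 'M[R]_(n, d)) (S : {set 'I_d}) : 'M[R]_n :=
  subset_cols X S *m invmx ((subset_cols X S)^T *m subset_cols X S)
  *m (subset_cols X S)^T.

Definition full_rank {n d : nat} (X : 'M[R]_(n, d)) (S : {set 'I_d}) : Prop :=
  (subset_cols X S)^T *m subset_cols X S \in unitmx.

Context {n d : nat} (X : 'M[R]_(n, d)).
Implicit Types S : {set 'I_d}.

Lemma proj_perpE S : proj_perp X S = 1%:M - proj X S.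
Proof. by []. Qed.

Lemma proj_sym S : (proj X S)^T = proj X S.
Proof. by rewrite /proj !trmx_mul trmxK trmx_inv trmx_mul trmxK mulmxA. Qed.

Lemma proj_cols S : full_rank X S -> proj X S *m subset_cols X S = subset_cols X S.
Proof. by move=> XS; rewrite /proj -!mulmxA mulVmx// mulmx1. Qed.

Lemma proj_idem S : full_rank X S -> proj X S *m proj X S = proj X S.
Proof. by move=> XS; rewrite {2}/proj !mulmxA proj_cols. Qed.

Lemma proj_trace S : full_rank X S -> \tr (proj X S) = #|S|%:R.
Proof. by move=> XS; rewrite /proj mxtrace_mulC mulmxA mulmxV// mxtrace1. Qed.

Lemma proj_subset S0 S : S0 \subset S -> full_rank X S ->
  proj X S *m proj X S0 = proj X S0.
Proof.
move=> S0S XS; rewrite {2}/proj !mulmxA.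
suff -> : proj X S *m subset_cols X S0 = subset_cols X S0 by [].
have -> : subset_cols X S0 = subset_cols X S *m ((sel S)^T *m sel S0).
  by rewrite !subset_cols_sel -mulmxA sel_subset.
by rewrite mulmxA proj_cols.
Qed.

Lemma proj_subset_r S0 S : S0 \subset S -> full_rank X S ->
  proj X S0 *m proj X S = proj X S0.
Proof.
move=> S0S XS; apply: trmx_inj.
by rewrite trmx_mul !proj_sym proj_subset.
Qed.

Lemma proj_perp_idem S : full_rank X S ->
  proj_perp X S *m proj_perp X S = proj_perp X S.
Proof.
move=> XS; rewrite proj_perpE mulmxBl !mulmxBr !mulmx1 !mul1mx proj_idem//.
by rewrite subrr subr0.
Qed.

Lemma proj_perp_sym S : (proj_perp X S)^T = proj_perp X S.
Proof. by rewrite proj_perpE linearB/= trmx1 proj_sym. Qed.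

Lemma sqnorm_idem (Q : 'M[R]_n) (v : 'cV[R]_n) : Q^T = Q -> Q *m Q = Q ->
  sqnorm (Q *m v) = bilin Q v v.
Proof. by move=> Qs Qi; rewrite sqnorm_mul Qs Qi. Qed.

End Projections.

(** * Deterministic comparison of the scores of a competitor and of the true support *)

Section ScoreComparison.
Context {R : realType} {n d : nat}.
Variables (X : 'M[R]_(n, d)) (e : 'cV[R]_n) (beta : 'cV[R]_d) (Sigma : 'M[R]_d).
Variables (S : {set 'I_d}) (tau sigma2 : R).
Let T := supp beta.
Hypothesis n0 : (0 < n)%N.
Hypothesis Spd : posdef Sigma.
Hypothesis restricted_eigenvalue : forall u : 'cV[R]_d,
  (forall j, j \notin S :|: T -> u j ord0 = 0) ->
  n%:R / 2 * bilin Sigma u u <= sqnorm (X *m u).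
Hypothesis signal : forall a : 'cV[R]_#|S|,
  4 * tau * #|T :\: S|%:R <= bilin Sigma (beta - sel S *m a) (beta - sel S *m a).

Definition excess_proj : 'M[R]_n := proj_perp X (S :&: T) - proj_perp X S.

Definition residual : 'cV[R]_n := proj_perp X S *m (X *m beta).

(** A null vector of the Gram matrix is killed by [X], so the restricted eigenvalue bound makes its
    Sigma-form nonpositive. Thus all projections that occur are genuine on the well-conditioned
    event. *)
Lemma full_rank_restricted (S' : {set 'I_d}) : S' \subset S :|: T -> full_rank X S'.
Proof.
move=> S'ST; apply: unitmx_inj => x; rewrite !subset_cols_sel => Gx.
apply: sel_inj; apply: contrapT => /eqP u0; have [_ Spos] := Spd.
have := restricted_eigenvalue (u := sel S' *m x).
have -> : sqnorm (X *m (sel S' *m x)) = 0.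
  by rewrite mulmxA sqnorm_mul /bilin -mulmxA Gx mulmx0 mxE.
have uS j : j \notin S :|: T -> (sel S' *m x) j ord0 = 0.
  by move=> jST; apply: selM_out; apply: contra jST; exact: (fintype.subsetP S'ST).
move=> /(_ uS); rewrite leNgt mulr_gt0 ?divr_gt0 ?ltr0n//.
exact: (Spos _ u0).
Qed.

Let fS : full_rank X S.
Proof. by apply: full_rank_restricted; exact: finset.subsetUl. Qed.

Let fT : full_rank X T.
Proof. by apply: full_rank_restricted; exact: finset.subsetUr. Qed.

Let fI : full_rank X (S :&: T).
Proof.
by apply: full_rank_restricted; apply: fintype.subset_trans (finset.subsetIl _ _) _;
  exact: finset.subsetUl.
Qed.

Let excess_projE : excess_proj = proj X S - proj X (S :&: T).
Proof. by rewrite /excess_proj !proj_perpE opprB addrC addrA subrK. Qed.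

Lemma excess_proj_sym : excess_proj^T = excess_proj.
Proof. by rewrite excess_projE linearB/= !proj_sym. Qed.

Lemma excess_proj_idem : excess_proj *m excess_proj = excess_proj.
Proof.
rewrite excess_projE mulmxBl !mulmxBr !proj_idem// proj_subset ?finset.subsetIl//.
by rewrite proj_subset_r ?finset.subsetIl// subrr subr0.
Qed.

Lemma excess_proj_trace : \tr excess_proj = #|S :\: T|%:R.
Proof.
rewrite excess_projE linearB/= !proj_trace// -natrB ?subset_leq_card ?finset.subsetIl//.
by rewrite -(cardsID T S) addKn.
Qed.

Lemma excess_proj_residual : excess_proj *m residual = 0.
Proof.
have EP : excess_proj *m proj X S = excess_proj.
  by rewrite excess_projE mulmxBl proj_idem// proj_subset_r ?finset.subsetIl.
by rewrite /residual mulmxA proj_perpE mulmxBr mulmx1 EP subrr mul0mx.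
Qed.

(** The residual is [X] applied to [beta] minus its least-squares fit on [S], a vector supported on
    [S :|: T]. The restricted eigenvalue bound then transfers the signal, with n / 2 times 4 tau
    giving 2 n tau. *)
Lemma residual_lower_bound : 2 * n%:R * #|T :\: S|%:R * tau <= sqnorm residual.
Proof.
have [a rE] : exists a, residual = X *m (beta - sel S *m a).
  pose XS := subset_cols X S.
  exists (invmx (XS^T *m XS) *m XS^T *m (X *m beta)).
  rewrite /residual proj_perpE mulmxBl mul1mx mulmxBr; congr (_ - _).
  by rewrite /proj /XS subset_cols_sel !mulmxA.
have supp_u j : j \notin S :|: T -> (beta - sel S *m a) j ord0 = 0.
  rewrite finset.in_setU negb_or => /andP[jS jT]; rewrite mxE [X in _ + X]mxE.
  by rewrite selM_out// subr0; move: jT; rewrite inE negbK => /eqP.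
rewrite rE; apply: le_trans (restricted_eigenvalue supp_u).
have -> : 2 * n%:R * #|T :\: S|%:R * tau = n%:R / 2 * (4 * tau * #|T :\: S|%:R).
  by field.
by rewrite ler_wpM2l ?divr_ge0.
Qed.

(** Multiply the difference by n - s = (n - t) - (l - k) and put r = |Pi_T^perp e|^2 / (n - t). The
    mismatch of divisors costs at most k r <= k n tau / 2, the penalty at most k n tau, and (3/4)
    |h|^2 >= (3/2) k n tau covers both. The penalty on the extra indices yields at least l n tau /
    2, which covers the noise allowance l n tau / 4. *)
Lemma score_lt :
  (2 * #|S| <= n)%N -> (2 * #|T| <= n)%N -> 0 < tau -> 16 * sigma2 <= n%:R * tau ->
  sqnorm e <= 4 * sigma2 * n%:R ->
  bilin excess_proj e e - 2 * bilin 1%:M residual e <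
    sqnorm residual / 4 + n%:R * #|S :\: T|%:R * tau / 4 ->
  score tau X (X *m beta + e) T < score tau X (X *m beta + e) S.
Proof.
move=> Sn Tn tau0 ntau en good.
set Y := X *m beta + e; set s := #|S|; set t := #|T|.
set k := #|T :\: S|; set l := #|S :\: T|.
have skl : s%:R + k%:R = t%:R + l%:R :> R.
  rewrite -!natrD /s /t /k /l -(cardsID T S) -(cardsID S T) finset.setIC.
  by congr (_%:R); rewrite -!addnA; congr (_ + _)%N; rewrite addnC.
have PT : proj_perp X T *m Y = proj_perp X T *m e.
  rewrite mulmxDr; set z := _ *m (X *m beta); suff -> : z = 0 by rewrite add0r.
  have bT : beta = sel T *m ((sel T)^T *m beta).
    by rewrite sel_supported// => j; rewrite inE negbK => /eqP.
  have XbT : X *m beta = subset_cols X T *m ((sel T)^T *m beta).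
    by rewrite subset_cols_sel -mulmxA -bT.
  by rewrite /z XbT mulmxA proj_perpE mulmxBl mul1mx proj_cols// subrr mul0mx.
have AT : sqnorm (proj_perp X T *m Y) = bilin (proj_perp X T) e e.
  by rewrite PT sqnorm_idem ?proj_perp_sym ?proj_perp_idem.
have AS : sqnorm (proj_perp X S *m Y) =
    sqnorm residual + 2 * bilin 1%:M residual e + bilin (proj_perp X S) e e.
  rewrite mulmxDr -/residual sqnormD sqnorm_idem ?proj_perp_sym ?proj_perp_idem//.
  have rP : residual^T *m proj_perp X S = residual^T.
    by rewrite -[in LHS]proj_perp_sym -trmx_mul /residual
      [_ *m (_ *m (_ *m _))]mulmxA proj_perp_idem.
  by congr (_ + 2 * _ + _); rewrite /bilin !mulmx1 mulmxA rP.
have bilinB (A B : 'M[R]_n) v : bilin (A - B) v v = bilin A v v - bilin B v v.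
  by rewrite /bilin mulmxBr mulmxBl mxE [X in _ + X]mxE.
(* Projecting away fewer columns leaves a larger residual; the difference is the form of a
   projection. *)
have AT0 : bilin (proj_perp X T) e e <= bilin (proj_perp X (S :&: T)) e e.
  rewrite -subr_ge0 -bilinB.
  have DE : proj_perp X (S :&: T) - proj_perp X T = proj X T - proj X (S :&: T).
    by rewrite !proj_perpE opprB addrC addrA subrK.
  rewrite DE -sqnorm_idem ?sqnorm_ge0//; first by rewrite linearB/= !proj_sym.
  rewrite mulmxBl !mulmxBr !proj_idem// proj_subset ?finset.subsetIr//.
  by rewrite proj_subset_r ?finset.subsetIr// subrr subr0.
have ATe : bilin (proj_perp X T) e e <= sqnorm e.
  rewrite proj_perpE bilinB -sqnorm_bilin gerBl -sqnorm_idem ?sqnorm_ge0//.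
    exact: proj_sym.
  exact: proj_idem.
have AT_ge0 : 0 <= bilin (proj_perp X T) e e.
  by rewrite -AT sqnorm_ge0.
move: good; rewrite /excess_proj bilinB => good.
have q0 := residual_lower_bound; rewrite -/k in q0.
rewrite /score AS AT -/s -/t.
move: good q0 AT0 ATe AT_ge0.
set q := sqnorm residual; set c := bilin 1%:M residual e.
set aS := bilin (proj_perp X S) e e; set aT := bilin (proj_perp X T) e e.
set a0 := bilin (proj_perp X (S :&: T)) e e.
rewrite -/l => good q0 AT0 ATe AT_ge0.
have nS : n%:R / 2 <= n%:R - s%:R :> R.
  by move: Sn; rewrite -(ler_nat R) natrM -/s; lra.
have nT : n%:R / 2 <= n%:R - t%:R :> R.
  by move: Tn; rewrite -(ler_nat R) natrM -/t; lra.
have np : 0 < n%:R :> R by rewrite ltr0n.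
have k0 : 0 <= k%:R :> R by [].
have l0 : 0 <= l%:R :> R by [].
have s0 : 0 <= s%:R :> R by [].
have dT : 0 < n%:R - t%:R :> R by lra.
have dS : 0 < n%:R - s%:R :> R by lra.
have sg0 : 0 <= sigma2 by have := sqnorm_ge0 e; nra.
pose r := aT / (n%:R - t%:R).
have rE : aT = r * (n%:R - t%:R) by rewrite /r divfK// gt_eqF.
have r0 : 0 <= r by rewrite divr_ge0// ltW.
(* The factor 8 is 4 from the bound on |e|^2 times 2 from n - t >= n / 2. *)
have r8 : r <= 8 * sigma2.
  rewrite /r ler_pdivrMr//; apply: le_trans ATe _; apply: le_trans en _.
  by nra.
rewrite -/r -(ltrD2r (- (s%:R * tau))) addrK ltr_pdivlMr//.
have H1 : aT - a0 <= 0 by lra.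
have H2 : (3 / 4) * q - n%:R * l%:R * tau / 4 < q + 2 * c + aS - a0 by lra.
have st : s%:R = t%:R + l%:R - k%:R :> R by lra.
have H3 : (l%:R - k%:R) * r + r * (n%:R - s%:R) = aT.
  by rewrite rE st; ring.
have H4 : k%:R * r <= k%:R * (n%:R * tau / 2) by rewrite ler_wpM2l//; lra.
have H5 : 0 <= l%:R * r by rewrite mulr_ge0.
have H6 : (t%:R * tau - s%:R * tau) * (n%:R - s%:R) =
   k%:R * tau * (n%:R - s%:R) - l%:R * tau * (n%:R - s%:R) by rewrite st; ring.
have H7 : k%:R * tau * (n%:R - s%:R) <= k%:R * tau * n%:R.
  by rewrite ler_wpM2l ?mulr_ge0 ?(ltW tau0)//; lra.
have H8 : l%:R * tau * (n%:R / 2) <= l%:R * tau * (n%:R - s%:R).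
  by rewrite ler_wpM2l ?mulr_ge0 ?(ltW tau0).
have H9 : 0 <= n%:R * l%:R * tau by rewrite !mulr_ge0 ?(ltW tau0).
rewrite -addrA mulrDl H6.
lra.
Qed.

End ScoreComparison.

(** * Lattice rounding *)

Section Rounding.
Context {R : realType}.

(* Rounding in the direction that makes the cross term nonpositive. *)
Lemma round_coordinate {n : nat} (y v : 'cV[R]_n) (x : R) :
  exists k : int, `|k%:~R - x| <= 1 /\
    sqnorm (y + (k%:~R - x) *: v) <= sqnorm y + sqnorm v.
Proof.
have /andP[f1 f2] := floor_itv x.
have v0 := sqnorm_ge0 v; have [c0|c0] := leP 0 (bilin 1%:M y v).
  exists (Num.floor x); move: f1 f2; rewrite intrD; set f := (Num.floor x)%:~R => f1 f2.
  split; first by rewrite ler_norml; lra.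
  rewrite sqnormD sqnormZ bilinZr.
  have H1 : (f - x) * bilin 1%:M y v <= 0 by rewrite mulr_le0_ge0//; lra.
  have H2 : (f - x) ^+ 2 * sqnorm v <= 1 * sqnorm v by rewrite ler_wpM2r//; nra.
  lra.
exists (Num.floor x + 1); move: f1 f2; rewrite !intrD; set f := (Num.floor x)%:~R => f1 f2.
split; first by rewrite ler_norml; lra.
rewrite sqnormD sqnormZ bilinZr.
have H1 : (f + 1 - x) * bilin 1%:M y v <= 0 by rewrite mulr_ge0_le0//; lra.
have H2 : (f + 1 - x) ^+ 2 * sqnorm v <= 1 * sqnorm v by rewrite ler_wpM2r//; nra.
lra.
Qed.

(** Coordinates are rounded greedily, each step starting from the point reached so far; rounding
    coordinate j adds at most the squared norm of column j. *)
Lemma round_vector {n m : nat} (V : 'M[R]_(n, m)) (x : 'cV[R]_m) :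
  exists z : 'cV[R]_m,
    (forall j, `|z j ord0 - x j ord0| <= 1 /\ exists k : int, z j ord0 = k%:~R) /\
    sqnorm (V *m z) <= sqnorm (V *m x) + \sum_j sqnorm (col j V).
Proof.
suff H p : (p <= m)%N -> exists z : 'cV[R]_m,
    [/\ forall j : 'I_m, (j < p)%N ->
          `|z j ord0 - x j ord0| <= 1 /\ exists k : int, z j ord0 = k%:~R,
        forall j : 'I_m, (p <= j)%N -> z j ord0 = x j ord0 &
        sqnorm (V *m z) <= sqnorm (V *m x) + \sum_(j < m | (j < p)%N) sqnorm (col j V)].
  have [z [z1 _ z3]] := H m (leqnn m); exists z; split.
    by move=> j; apply: z1; exact: ltn_ord.
  by rewrite [X in _ <= _ + X](eq_bigl (fun j : 'I_m => (j < m)%N))// => j; rewrite ltn_ord.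
elim: p => [_|p IHp pm].
  by exists x; split => //; rewrite big_pred0// addr0.
have [z [z1 z2 z3]] := IHp (ltnW pm); pose p' := Ordinal pm.
have [k [k1 k2]] := round_coordinate (V *m z) (col p' V) (x p' ord0).
pose z' := z + (k%:~R - x p' ord0) *: delta_mx p' ord0.
have z'p : z' p' ord0 = k%:~R.
  by rewrite !mxE !eqxx mulr1 (z2 p')// addrC subrK.
have z'n j : j != p' -> z' j ord0 = z j ord0.
  by move=> jp; rewrite !mxE (negbTE jp) mulr0 addr0.
exists z'; split.
- move=> j; rewrite ltnS leq_eqVlt => /orP[/eqP jp|jp].
    have -> : j = p' by exact: val_inj.
    by rewrite z'p; split => //; exists k.
  have jp' : j != p' by rewrite -val_eqE/= neq_ltn jp.
  by rewrite z'n//; exact: z1.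
- move=> j pj; have jp' : j != p' by rewrite -val_eqE/= neq_ltn pj orbT.
  by rewrite z'n// z2// ltnW.
have -> : V *m z' = V *m z + (k%:~R - x p' ord0) *: col p' V.
  by rewrite mulmxDr -scalemxAr colE.
apply: le_trans k2 _; rewrite (bigD1 p')//= [X in _ <= _ + X]addrC addrA lerD2r.
rewrite [X in _ <= _ + X](eq_bigl (fun j : 'I_m => (j < p)%N))// => j.
by rewrite ltnS [RHS]ltn_neqAle andbC.
Qed.

(** Integer vectors with entries of modulus at most [M], given by signs and moduli so that the index
    type is finite and union bounds apply. A zero entry has two codes, which only enlarges the
    sums. *)
Definition lattice_vec {m M : nat} (k : {ffun 'I_m -> bool * 'I_M.+1}) : 'cV[R]_m :=
  \col_j ((-1) ^+ (k j).1 * (k j).2%:R).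

Lemma lattice_vecP {m M : nat} (z : 'cV[R]_m) :
  (forall j, exists k : int, z j ord0 = k%:~R) -> sqnorm z <= M%:R ->
  exists k : {ffun 'I_m -> bool * 'I_M.+1}, lattice_vec k = z.
Proof.
move=> zint zM.
have H j : exists p : bool * 'I_M.+1, z j ord0 = (-1) ^+ p.1 * p.2%:R.
  have [k zk] := zint j.
  (* For an integer, |k| <= k^2, and k^2 is at most the squared norm. *)
  have kM : (`|k| <= M)%N.
    have k2 : (`|k| ^ 2)%:R <= M%:R :> R.
      apply: le_trans zM; rewrite /sqnorm (bigD1 j)//= zk.
      apply: (@le_trans _ _ ((k%:~R : R) ^+ 2)); last first.
        by rewrite lerDl; apply: sumr_ge0 => i _; exact: sqr_ge0.
      by rewrite natrX natr_absz -rmorphXn/= -normrX ger0_norm ?sqr_ge0// rmorphXn.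
    rewrite ler_nat in k2; apply: leq_trans k2.
    by case: `|k|%N => // p; rewrite expnS leq_pmulr ?expn_gt0.
  exists (k < 0, Ordinal (kM : (`|k| < M.+1)%N)) => /=.
  rewrite zk natr_absz; have [k0|k0] := ltrP k 0; last by rewrite expr0 mul1r ger0_norm.
  by rewrite expr1 mulN1r ltr0_norm// mulrNz opprK.
pose f j := projT1 (cid (H j)); exists (finfun f); apply/matrixP => j i.
by rewrite mxE ffunE (ord1 i) -(projT2 (cid (H j))).
Qed.

(* With eta = 1 / (20 sqrt m), the unit vector a is rounded to eta z with
   |eta z - a| <= 1 / 20, whence |z|^2 <= 400 m (21 / 20)^2 = 441 m. *)
Lemma lattice_near {n m : nat} (V : 'M[R]_(n, m)) (a : 'cV[R]_m) (N eta : R) :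
  sqnorm a = 1 -> 0 < eta -> eta ^+ 2 * m%:R = 400^-1 ->
  (forall j, sqnorm (col j V) <= 4 * N) -> sqnorm (V *m a) <= N / 2 ->
  exists k : {ffun 'I_m -> bool * 'I_(441 * m).+1},
    [/\ sqnorm (lattice_vec k) <= 441 * m%:R,
        9 / 10 <= eta ^+ 2 * sqnorm (lattice_vec k) &
        eta ^+ 2 * sqnorm (V *m lattice_vec k) <= 51 / 100 * N].
Proof.
move=> a1 eta0 etam colV Va; have etaN0 : eta != 0 by rewrite gt_eqF.
have [z [z1 z2]] := round_vector V (eta^-1 *: a).
pose r := eta *: z - a.
have rE : sqnorm r <= 400^-1.
  rewrite -etam mulr_natr -[m in _ *+ m]card_ord -sumr_const.
  apply: ler_sum => j _; have [] := z1 j.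
  have -> : r j ord0 = eta * (z j ord0 - (eta^-1 *: a) j ord0).
    by rewrite !mxE mulrBr mulrA divff// mul1r.
  move=> zj _; rewrite exprMn -[leRHS]mulr1 ler_wpM2l ?sqr_ge0//.
  by rewrite -[X in X <= _]real_normK ?num_real// exprn_ile1.
have zr : eta ^+ 2 * sqnorm z = 1 + 2 * bilin 1%:M a r + sqnorm r.
  have {1}-> : z = eta^-1 *: (a + r) by rewrite /r addrC subrK scalerA mulVf// scale1r.
  by rewrite sqnormZ mulrA -exprMn divff// expr1n mul1r sqnormD a1.
have CS := psd_cauchy_schwarz a r (trmx1 _ _) (@psd1 _ _).
rewrite -!sqnorm_bilin a1 mul1r in CS.
have r0 := sqnorm_ge0 r; set c := bilin 1%:M a r in zr CS.
(* From c^2 <= |r|^2 <= 1/400. The scaled vector thus has squared norm at least 1 - 2/20 = 9/10 and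
   at most 1 + 2/20 + 1/400 = 441/400. *)
have c20 : - 20^-1 <= c <= 20^-1 by apply/andP; split; nra.
have /andP[c1 c2] := c20.
have zlo : 9 / 10 <= eta ^+ 2 * sqnorm z by rewrite zr; lra.
have zhi : sqnorm z <= 441 * m%:R.
  have e2 : 0 < eta ^+ 2 by rewrite exprn_gt0.
  by rewrite -(ler_pM2l e2) mulrCA etam zr; lra.
have zM : sqnorm z <= (441 * m)%:R by rewrite natrM.
have [k kz] := lattice_vecP (fun j => (z1 j).2) zM.
exists k; rewrite kz; split => //.
have e2 : 0 <= eta ^+ 2 by exact: sqr_ge0.
apply: le_trans (ler_wpM2l e2 z2) _.
rewrite -scalemxAr sqnormZ mulrDr mulrA -exprMn divff// expr1n mul1r.
(* Scaled by eta^2 = 1 / (400 m), the rounding error is at most N / 100, which turns N / 2 into 51 N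
   / 100. *)
have : \sum_j sqnorm (col j V) <= m%:R * (4 * N).
  rewrite mulr_natl -[m in _ *+ m]card_ord -sumr_const.
  by apply: ler_sum => j _.
move=> /(ler_wpM2l e2); rewrite [X in _ <= X]mulrA etam; lra.
Qed.

(** In the coordinates given by [B] the form of Sigma on vectors supported on [H] is the squared
    norm, and both sides are homogeneous. So a violation occurs at a unit vector, where
    [lattice_near] produces a forbidden lattice vector. *)
Lemma restricted_eigenvalue_lattice {n d : nat} (X : 'M[R]_(n, d)) (Sigma : 'M[R]_d)
    (H : {set 'I_d}) (B : 'M[R]_#|H|) (N eta : R) :
  posdef Sigma -> B^T *m ((sel H)^T *m Sigma *m sel H) *m B = 1%:M ->
  0 < eta -> eta ^+ 2 * #|H|%:R = 400^-1 ->
  (forall j, sqnorm (X *m col j (sel H *m B)) <= 4 * N) ->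
  (forall k : {ffun 'I_#|H| -> bool * 'I_(441 * #|H|).+1},
     sqnorm (lattice_vec k) <= 441 * #|H|%:R ->
     9 / 10 <= eta ^+ 2 * sqnorm (lattice_vec k) ->
     51 / 100 * N < eta ^+ 2 * sqnorm (X *m (sel H *m B *m lattice_vec k))) ->
  forall u : 'cV[R]_d, (forall j, j \notin H -> u j ord0 = 0) ->
    N / 2 * bilin Sigma u u <= sqnorm (X *m u).
Proof.
move=> Spd BSB eta0 etam colX latX u uH.
have Bu : B \in unitmx by have [] := mulmx1_unit BSB.
pose W := sel H *m B; pose a := invmx B *m ((sel H)^T *m u).
have uE : u = W *m a.
  by rewrite /W /a !mulmxA mulmxK// -mulmxA sel_supported.
have SE : bilin Sigma u u = sqnorm a.
  rewrite uE bilin_mul sqnorm_bilin; congr (bilin _ a a).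
  by rewrite -BSB /W trmx_mul !mulmxA.
have [a0|an0] := eqVneq a 0; first by rewrite SE a0 sqnorm0 mulr0 sqnorm_ge0.
have s0 := sqnorm_gt0 an0; pose c := Num.sqrt (sqnorm a).
have c0 : 0 < c by rewrite sqrtr_gt0.
have c2 : c ^+ 2 = sqnorm a by rewrite sqr_sqrtr// ltW.
pose a' := c^-1 *: a.
have a'1 : sqnorm a' = 1 by rewrite sqnormZ exprVn c2 mulVf// gt_eqF.
have aE : a = c *: a' by rewrite scalerA divff ?scale1r// gt_eqF.
clearbody a'; rewrite SE uE aE -!scalemxAr !sqnormZ a'1 mulr1 mulrC.
rewrite ler_wpM2l ?sqr_ge0// mulmxA.
rewrite leNgt; apply/negP => lt.
have colV j : sqnorm (col j (X *m W)) <= 4 * N by rewrite colE -mulmxA -colE.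
have [k [k1 k2 k3]] := lattice_near a'1 eta0 etam colV (ltW lt).
have := latX k k1 k2; rewrite ltNge => /negP; apply.
by rewrite mulmxA.
Qed.

End Rounding.

(** * Tail bounds *)

Section Chernoff.
Context {disp : measure_display} {T : measurableType disp} {R : realType}
  (P : probability T R).

Lemma measurable_set_le (f g : T -> R) :
  measurable_fun setT f -> measurable_fun setT g -> measurable [set x | f x <= g x].
Proof.
move=> mf mg; have := measurable_fun_ler mf mg measurableT (Y := [set true]).
by rewrite setTI; apply.
Qed.

Lemma measurable_set_lt (f g : T -> R) :
  measurable_fun setT f -> measurable_fun setT g -> measurable [set x | f x < g x].
Proof.
move=> mf mg; have := measurable_fun_ltr mf mg measurableT (Y := [set true]).
by rewrite setTI; apply.
Qed.

Lemma probability_le_integral (A : set T) (f : T -> R) : measurable A ->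
  measurable_fun setT f -> (forall w, 0 <= f w) -> (forall w, A w -> 1 <= f w) ->
  (P A <= \int[P]_w (f w)%:E)%E.
Proof.
move=> mA mf f0 Af; have -> : P A = (\int[P]_w (\1_A w)%:E)%E.
  by rewrite integral_indic// setIT.
apply: ge0_le_integral => //.
- by apply/measurable_EFinP.
- by apply/measurable_EFinP.
- move=> w _; rewrite lee_fin indicE; have [wA|wA] := boolP (w \in A) => //.
  by apply: Af; rewrite inE in wA.
Qed.

Lemma measurable_sqnorm {n : nat} (v : T -> 'cV[R]_n) : measurable_mx v ->
  measurable_fun setT (fun w => sqnorm (v w)).
Proof. by move=> mv; apply: measurable_sum => i; exact: measurable_funX. Qed.

Lemma measurable_bilin {m n : nat} (A : T -> 'M[R]_(m, n)) u v :
  measurable_mx A -> measurable_mx u -> measurable_mx v ->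
  measurable_fun setT (fun w => bilin (A w) (u w) (v w)).
Proof.
move=> mA mu mv; apply: measurable_mxM => //; apply: measurable_mxM => //.
exact: measurable_mx_tr.
Qed.

Lemma measurable_proj_perp {n d : nat} (X : T -> 'M[R]_(n, d)) S :
  measurable_mx X -> measurable_mx (fun w => proj_perp (X w) S).
Proof.
move=> mX; have mXS : measurable_mx (fun w => subset_cols (X w) S).
  exact: measurable_mxsub.
apply: measurable_mxB; first exact: measurable_mx_cst.
apply: measurable_mxM; last exact: measurable_mx_tr.
apply: measurable_mxM => //; apply: measurable_invmx.
by apply: measurable_mxM => //; exact: measurable_mx_tr.
Qed.

Lemma measurable_set_exists (I : finType) (A : I -> set T) :
  (forall i, measurable (A i)) -> measurable [set w | exists i, A i w].
Proof.
move=> mA; rewrite (_ : [set w | _] = \bigcup_(i in [set: I]) A i).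
  exact: fin_bigcup_measurable.
by apply/seteqP; split => w /= [i]; [move=> Ai; exists i|move=> _ Ai; exists i].
Qed.

Lemma measurable_set_prop (Q : Prop) (A : set T) :
  measurable A -> measurable [set w | Q /\ A w].
Proof.
move=> mA; have [q|q] := pselect Q.
  by rewrite (_ : [set w | _] = A)//; apply/seteqP; split => w //= [].
by rewrite (_ : [set w | _] = set0)//; apply/seteqP; split => w //= [].
Qed.

Lemma probability_exists_le (I : finType) (A : I -> set T) (b : I -> R) :
  (forall i, measurable (A i)) -> (forall i, (P (A i) <= (b i)%:E)%E) ->
  (P [set w | exists i, A i w] <= (\sum_i b i)%:E)%E.
Proof.
move=> mA Ab; have -> : [set w | exists i, A i w] = \big[setU/set0]_(i : I) A i.
  apply/seteqP; split=> w /=; rewrite -bigcup_seq/=.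
    by move=> [i Ai]; exists i => //=; rewrite mem_index_enum.
  by move=> [i _ Ai]; exists i.
elim: (index_enum I) => [|i s IHs]; first by rewrite !big_nil measure0.
rewrite !big_cons EFinD; apply: le_trans (measureU2 _ _ _) _ => //.
  exact: bigsetU_measurable.
by apply: leeD; [exact: Ab|exact: IHs].
Qed.

End Chernoff.

(** * Moments of the design and the noise, and conditioning on the design *)

Section LinearModel.
Context {disp : measure_display} {T : measurableType disp} {R : realType}
  (P : probability T R) {n d : nat} (beta : 'cV[R]_d) (Sigma : 'M[R]_d) (sigma2 : R)
  (XY : 'I_n -> {RV P >-> (d.-tuple R * R)%type}).
Hypothesis sigma0 : 0 < sigma2.
Hypothesis iid : iid_linear_model beta Sigma sigma2 XY.

Definition linear_response (x : d.-tuple R) : R := \sum_j tnth x j * beta j ord0.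

(** The model provides its noise variables existentially, row by row. Recomputed from the data, the
    noise is a function of the row, so independence across rows is inherited from [XY]. *)
Definition row_noise (p : d.-tuple R * R) : R := p.2 - linear_response p.1.

Definition noise (w : T) : 'cV[R]_n := \col_i row_noise (XY i w).

Lemma data_YE w : data_Y XY w = data_X XY w *m beta + noise w.
Proof.
apply/matrixP => i j; rewrite !mxE /row_noise /linear_response.
rewrite (_ : \sum_k _ = \sum_j0 tnth (XY i w).1 j0 * beta j0 ord0).
  by rewrite addrC subrK.
by apply: eq_bigr => k _; rewrite mxE (ord1 j).
Qed.

Lemma measurable_linear_response : measurable_fun setT linear_response.
Proof.
by apply: measurable_sum => j; apply: measurable_funM => //; exact: measurable_tnth.
Qed.

Lemma measurable_row_noise : measurable_fun setT row_noise.
Proof.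
apply: measurable_funB => //.
exact: (measurableT_comp measurable_linear_response measurable_fst).
Qed.

Lemma measurable_noise : measurable_mx noise.
Proof.
move=> i j; under eq_fun do rewrite mxE.
exact: (measurableT_comp measurable_row_noise).
Qed.

Lemma measurable_data_X : measurable_mx (data_X XY).
Proof.
move=> i j; under eq_fun do rewrite mxE.
apply: (measurableT_comp (measurable_tnth j)).
exact: (measurableT_comp measurable_fst).
Qed.

Lemma row_noise_indep i : forall A B, measurable A -> measurable B ->
  P ((fst \o XY i) @^-1` A `&` (row_noise \o XY i) @^-1` B) =
  (P ((fst \o XY i) @^-1` A) * P ((row_noise \o XY i) @^-1` B))%E.
Proof.
move=> A B mA mB; have [_ /(_ i)[X [eps [_ _ Xeps XYE]]]] := iid.
have -> : fst \o XY i = X by apply/funext => w /=; rewrite XYE.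
have -> : row_noise \o XY i = eps; last exact: Xeps.
by apply/funext => w /=; rewrite XYE /row_noise /linear_response/= addrAC subrr add0r.
Qed.

Lemma integral_row_noise i (f : R -> \bar R) :
  measurable_fun setT f -> (forall x, 0 <= f x)%E ->
  (\int[P]_w f (row_noise (XY i w)) = \int[gauss (Num.sqrt sigma2)]_x f x)%E.
Proof.
move=> mf f0; have [_ /(_ i)[X [eps [_ elaw _ XYE]]]] := iid.
rewrite -(integral_normal_law elaw mf f0); apply: eq_integral => w _.
by congr (f _); rewrite XYE /row_noise /linear_response/= addrAC subrr add0r.
Qed.

(** With x = L Z, the inner product with v is a linear form in independent standard normals with
    coefficient vector L^T v, of squared norm v^T Sigma v. *)
Lemma integral_row_quad i (v : 'cV[R]_d) (s : R) : 2 * s * bilin Sigma v v < 1 ->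
  (\int[P]_w (expR (s * (\sum_j tnth (XY i w).1 j * v j ord0) ^+ 2))%:E =
   (Num.sqrt (1 - 2 * s * bilin Sigma v v))^-1%:E)%E.
Proof.
have [_ /(_ i)[X [eps [[L [Z [LS Zlaw Zmi XE]]] _ _ XYE]]]] := iid.
have -> : bilin Sigma v v = \sum_k (L^T *m v) k ord0 ^+ 2.
  rewrite -LS -[RHS]/(sqnorm (L^T *m v)) sqnorm_bilin bilin_mul trmxK mulmx1.
  by rewrite mulmxE.
move=> sv; rewrite -(integral_expR_sqr_linear Zlaw Zmi sv); apply: eq_integral => w _.
congr (expR (_ * _ ^+ 2))%:E; rewrite XYE/=.
transitivity (\sum_j \sum_k L j k * Z k w * v j ord0).
  by apply: eq_bigr => j _; rewrite XE big_distrl.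
rewrite exchange_big/=; apply: eq_bigr => k _; rewrite mxE big_distrl/=.
by apply: eq_bigr => j _; rewrite mxE mulrAC.
Qed.

Lemma prode_EFin (I : Type) (r : seq I) (f : I -> R) :
  (\prod_(i <- r) (f i)%:E = (\prod_(i <- r) f i)%:E)%E.
Proof. by elim/big_rec2 : _ => // i x y _ ->; rewrite EFinM. Qed.

Lemma integral_data_quad (v : 'cV[R]_d) (s : R) : 2 * s * bilin Sigma v v < 1 ->
  (\int[P]_w (expR (s * sqnorm (data_X XY w *m v)))%:E =
   ((Num.sqrt (1 - 2 * s * bilin Sigma v v))^-1 ^+ n)%:E)%E.
Proof.
move=> sv; pose f (i : 'I_n) (p : d.-tuple R * R) :=
  expR (s * (\sum_j tnth p.1 j * v j ord0) ^+ 2).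
have mf i : measurable_fun setT (f i).
  apply: measurableT_comp => //; apply: measurable_funM => //; apply: measurable_funX.
  apply: measurable_sum => j; apply: measurable_funM => //.
  exact: (measurableT_comp (measurable_tnth j) measurable_fst).
transitivity (\int[P]_w (\prod_i f i (XY i w))%:E)%E.
  apply: eq_integral => w _; congr EFin; rewrite /sqnorm mulr_sumr expR_sum.
  apply: eq_bigr => i _; congr (expR (_ * _ ^+ 2)).
  by rewrite mxE; apply: eq_bigr => j _; rewrite mxE.
rewrite (integral_prod_indep iid.1 mf) => [|i p]; last exact: expR_ge0.
rewrite (eq_bigr (fun=> (Num.sqrt (1 - 2 * s * bilin Sigma v v))^-1%:E)).
  by rewrite prode_EFin prodr_const card_ord.
by move=> i _; exact: integral_row_quad.
Qed.

Lemma integral_noise_quad (s : R) : 2 * s * sigma2 < 1 ->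
  (\int[P]_w (expR (s * sqnorm (noise w)))%:E =
   ((Num.sqrt (1 - 2 * s * sigma2))^-1 ^+ n)%:E)%E.
Proof.
move=> sv; pose f (i : 'I_n) p := expR (s * row_noise p ^+ 2).
have mf i : measurable_fun setT (f i).
  apply: measurableT_comp => //; apply: measurable_funM => //; apply: measurable_funX.
  exact: measurable_row_noise.
transitivity (\int[P]_w (\prod_i f i (XY i w))%:E)%E.
  apply: eq_integral => w _; congr EFin; rewrite /sqnorm mulr_sumr expR_sum.
  by apply: eq_bigr => i _; rewrite mxE.
rewrite (integral_prod_indep iid.1 mf) => [|i p]; last exact: expR_ge0.
rewrite (eq_bigr (fun=> (Num.sqrt (1 - 2 * s * sigma2))^-1%:E)).
  by rewrite prode_EFin prodr_const card_ord.
move=> i _; have mg : measurable_fun setT (fun x : R => (expR (s * x ^+ 2))%:E).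
  apply/measurable_EFinP; apply: measurableT_comp => //.
  by apply: measurable_funM => //; exact: measurable_funX.
rewrite (integral_row_noise i mg)//.
transitivity (\int[gauss (Num.sqrt sigma2)]_x (expR (s * x ^+ 2 + 0 * x))%:E)%E.
  by apply: eq_integral => x _; rewrite mul0r addr0.
rewrite integral_gauss_quad.
- by rewrite expr0n/= !mul0r expR0 mulr1 sqr_sqrtr// ltW.
- by rewrite gt_eqF// sqrtr_gt0.
- by rewrite sqr_sqrtr// ltW.
Qed.

Lemma integral_noise_linear (h : 'cV[R]_n) :
  (\int[P]_w (expR ((h^T *m noise w) ord0 ord0))%:E =
   (expR (Num.sqrt sigma2 ^+ 2 / 2 * (h^T *m h) ord0 ord0))%:E)%E.
Proof.
pose f (i : 'I_n) p := expR (h i ord0 * row_noise p).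
have mf i : measurable_fun setT (f i).
  apply: measurableT_comp => //; apply: measurable_funM => //.
  exact: measurable_row_noise.
transitivity (\int[P]_w (\prod_i f i (XY i w))%:E)%E.
  apply: eq_integral => w _; congr EFin; rewrite mxE expR_sum.
  by apply: eq_bigr => i _; rewrite !mxE.
rewrite (integral_prod_indep iid.1 mf) => [|i p]; last exact: expR_ge0.
rewrite (eq_bigr (fun i => (expR (Num.sqrt sigma2 ^+ 2 / 2 * h i ord0 ^+ 2))%:E)).
  rewrite prode_EFin -expR_sum mxE -mulr_sumr; congr (expR (_ * _))%:E.
  by apply: eq_bigr => i _; rewrite mxE expr2.
move=> i _; have mg : measurable_fun setT (fun x : R => (expR (h i ord0 * x))%:E).
  by apply/measurable_EFinP; apply: measurableT_comp => //; exact: measurable_funM.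
rewrite (integral_row_noise i mg)//.
transitivity (\int[gauss (Num.sqrt sigma2)]_x (expR (0 * x ^+ 2 + h i ord0 * x))%:E)%E.
  by apply: eq_integral => x _; rewrite mul0r add0r.
rewrite integral_gauss_quad.
- rewrite mulr0 mul0r subr0 sqrtr1 invr1 mul1r mulr1; congr (expR _)%:E.
  by field.
- by rewrite gt_eqF// sqrtr_gt0.
- by rewrite mulr0 mul0r.
Qed.

Definition tuple_mx (x : n.-tuple (d.-tuple R)) : 'M[R]_(n, d) :=
  \matrix_(i, j) tnth (tnth x i) j.

Definition tuple_col (y : n.-tuple R) : 'cV[R]_n := \col_i tnth y i.

Lemma measurable_tuple_mx : measurable_mx tuple_mx.
Proof.
move=> i j; under eq_fun do rewrite mxE.
exact: (measurableT_comp (measurable_tnth j) (measurable_tnth i)).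
Qed.

Lemma measurable_tuple_col : measurable_mx tuple_col.
Proof.
by move=> i j; under eq_fun do rewrite mxE; exact: measurable_tnth.
Qed.

(** Conditioning on the design: by Tonelli the probability is the average, over the design, of
    probabilities in which the design is frozen, so a bound uniform in [X] suffices. *)
Lemma probability_design_noise_le (K : 'M[R]_(n, d) -> 'cV[R]_n -> Prop) (b : R) :
  measurable [set x : n.-tuple (d.-tuple R) * n.-tuple R |
    K (tuple_mx x.1) (tuple_col x.2)] ->
  (forall X, (P [set w | K X (noise w)] <= b%:E)%E) ->
  (P [set w | K (data_X XY w) (noise w)] <= b%:E)%E.
Proof.
set K' := [set x | _] => mK Kb.
pose U w := [tuple fst (XY i w) | i < n].
pose V w := [tuple row_noise (XY i w) | i < n].
have UE w : tuple_mx (U w) = data_X XY w.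
  by apply/matrixP => i j; rewrite !mxE tnth_mktuple.
have VE w : tuple_col (V w) = noise w.
  by apply/matrixP => i j; rewrite !mxE tnth_mktuple.
have mU : measurable_fun setT U.
  apply: (measurable_fun_mktuple (f := fun i w => fst (XY i w))) => i.
  exact: (measurableT_comp measurable_fst).
have mV : measurable_fun setT V.
  apply: (measurable_fun_mktuple (f := fun i w => row_noise (XY i w))) => i.
  exact: (measurableT_comp measurable_row_noise).
have mpre (f : T -> n.-tuple (d.-tuple R) * n.-tuple R) :
    measurable_fun setT f -> measurable [set w | K' (f w)].
  by move=> mf; have := mf measurableT _ mK; rewrite setTI.
have -> : [set w | K (data_X XY w) (noise w)] = [set w | K' (U w, V w)].
  by apply/funext => w /=; rewrite /K'/= UE VE.
have mUV : measurable_fun setT (fun w => (U w, V w)) by exact: measurable_fun_pair.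
have P1 (g : T -> n.-tuple (d.-tuple R) * n.-tuple R) : measurable_fun setT g ->
    P [set w | K' (g w)] = (\int[P]_w (\1_K' (g w))%:E)%E.
  move=> mg; transitivity (\int[P]_w (\1_[set w | K' (g w)] w)%:E)%E.
    by have mA := mpre _ mg; rewrite integral_indic// setIT.
  by apply: eq_integral => w _; rewrite !indicE; congr ((_ : bool)%:R)%:E.
have [mi _] := iid.
have mF : measurable_fun setT (fun x : n.-tuple (d.-tuple R) * n.-tuple R =>
    (\1_K' x : R)%:E) by exact/measurable_EFinP/measurable_indic.
have F0 x : (0 <= (\1_K' x : R)%:E)%E by rewrite lee_fin.
rewrite (P1 _ mUV) (integral_indep_tuples (W := XY) (f := fun=> fst)
  (g := fun=> row_noise) (F := fun x => (\1_K' x)%:E))//; last 2 first.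
- by move=> i; exact: measurable_row_noise.
- exact: row_noise_indep.
apply: (@le_trans _ _ (\int[P]_w b%:E)%E); last first.
  rewrite integral_cst// [X in (_ * X)%E](_ : _ = 1%E) ?mule1//.
  exact: probability_setT.
have mG : measurable_fun setT (fun z : T * T => (\1_K' (U z.1, V z.2) : R)%:E).
  apply: (measurableT_comp mF); apply: measurable_fun_pair => /=.
    exact: (measurableT_comp mU measurable_fst).
  exact: (measurableT_comp mV measurable_snd).
have Ub w : (\int[P]_w' (\1_K' (U w, V w') : R)%:E <= b%:E)%E.
  have mUw : measurable_fun setT (fun w' => (U w, V w')).
    by apply: measurable_fun_pair => //; exact: measurable_cst.
  rewrite -(P1 _ mUw) /K'/= UE; apply: le_trans (Kb (data_X XY w)).
  by under eq_set => w' do rewrite VE.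
apply: ge0_le_integral => //.
- by move=> w _; apply: integral_ge0.
- have G0 z : (0 <= (\1_K' (U z.1, V z.2) : R)%:E)%E by exact: F0.
  exact: (measurable_fun_fubini_tonelli_F (m2 := P) _ mG G0).
- by move=> w _; exact: Ub.
Qed.


End LinearModel.

Section TailBounds.
Context {disp : measure_display} {T : measurableType disp} {R : realType}
  (P : probability T R).

Lemma chernoff_bound (A : set T) (f : T -> R) (a M : R) : measurable A ->
  measurable_fun setT f -> (forall w, A w -> a <= f w) ->
  (\int[P]_w (expR (f w))%:E <= M%:E)%E -> (P A <= (M * expR (- a))%:E)%E.
Proof.
move=> mA mf Af fM.
apply: le_trans (probability_le_integral P
  (f := fun w => expR (f w) * expR (- a)) _ _ _ _) _.
- exact: mA.
- by apply: measurable_funM => //; exact: measurableT_comp.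
- by move=> w; rewrite mulr_ge0 ?expR_ge0.
- move=> w /Af af; rewrite -expRD -expR0 ler_expR; lra.
have mef : measurable_fun setT (fun w => (expR (f w))%:E).
  by apply/measurable_EFinP; exact: measurableT_comp.
under eq_integral do rewrite EFinM.
rewrite ge0_integralZr// ?lee_fin ?expR_ge0//.
by rewrite EFinM lee_wpmul2r ?lee_fin ?expR_ge0.
Qed.

(** Converts the normalizing factors of Gaussian moments into exponentials, so that only the
    inequality 1 + x <= exp x is needed for numerical estimates. *)
Lemma inv_sqrt_le_expR (x c : R) : expR (- (2 * c)) <= x -> (Num.sqrt x)^-1 <= expR c.
Proof.
move=> xc; have x0 : 0 < x by apply: lt_le_trans xc; exact: expR_gt0.
rewrite -[expR c]invrK -expRN lef_pV2 ?posrE ?sqrtr_gt0 ?expR_gt0//.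
rewrite -[leLHS]ger0_norm ?expR_ge0// -sqrtr_sqr ler_wsqrtr//.
by apply: le_trans xc; rewrite -expRM_natl ler_expR mulrN.
Qed.

Lemma inv_sqrt_half : (Num.sqrt 2^-1)^-1 <= expR (2^-1) :> R.
Proof.
apply: inv_sqrt_le_expR; have e1 := expR_ge1Dx (1 : R).
have -> : 2 * 2^-1 = 1 :> R by lra.
by rewrite expRN lef_pV2 ?posrE ?expR_gt0//; lra.
Qed.

Context {n d : nat} (beta : 'cV[R]_d) (Sigma : 'M[R]_d) (sigma2 : R)
  (XY : 'I_n -> {RV P >-> (d.-tuple R * R)%type}).
Hypothesis sigma0 : 0 < sigma2.
Hypothesis iid : iid_linear_model beta Sigma sigma2 XY.

Let measurable_sqnorm_data (v : 'cV[R]_d) :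
  measurable_fun setT (fun w => sqnorm (data_X XY w *m v)).
Proof.
apply: measurable_sqnorm; apply: measurable_mxM; last exact: measurable_mx_cst.
exact: measurable_data_X.
Qed.

Lemma data_upper_tail (v : 'cV[R]_d) : bilin Sigma v v = 1 ->
  (P [set w | (4 * n%:R < sqnorm (data_X XY w *m v))%R] <= (expR (- (n%:R / 2)))%:E)%E.
Proof.
(* With exponent 1/4 each row contributes at most e^(1/2), and the threshold 4 n contributes e^(-
   n). *)
move=> v1; have s1 : 2 * 4^-1 * bilin Sigma v v < 1 by rewrite v1; lra.
have := integral_data_quad iid s1; rewrite v1 => E.
apply: le_trans (chernoff_bound (f := fun w => 4^-1 * sqnorm (data_X XY w *m v))
  (a := n%:R) (M := expR 2^-1 ^+ n) _ _ _ _) _.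
- exact: measurable_set_lt.
- exact: measurable_funM.
- by move=> w /=; lra.
- rewrite E lee_fin lerXn2r ?nnegrE ?invr_ge0 ?sqrtr_ge0 ?expR_ge0//.
  have -> : 1 - 2 * 4^-1 * 1 = 2^-1 :> R by lra.
  exact: inv_sqrt_half.
by rewrite -expRM_natl -expRD lee_fin ler_expR; lra.
Qed.

Lemma data_lower_tail (v : 'cV[R]_d) : 9 / 10 <= bilin Sigma v v ->
  (P [set w | (sqnorm (data_X XY w *m v) <= 51 / 100 * n%:R)%R] <=
   (expR (- (n%:R / 50)))%:E)%E.
Proof.
(* With exponent -1/10 each row contributes at most (59/50)^(-1/2) <= e^(-3/40), and -3/40 + 51/1000
   = -24/1000 is below -1/50. *)
move=> v1; have s1 : 2 * (- 10^-1) * bilin Sigma v v < 1 by lra.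
have E := integral_data_quad iid s1.
apply: le_trans (chernoff_bound (f := fun w => - 10^-1 * sqnorm (data_X XY w *m v))
  (a := - (51 / 1000 * n%:R)) (M := expR (- (3 / 40)) ^+ n) _ _ _ _) _.
- exact: measurable_set_le.
- exact: measurable_funM.
- by move=> w /=; lra.
- rewrite E lee_fin lerXn2r ?nnegrE ?invr_ge0 ?sqrtr_ge0 ?expR_ge0//.
  apply: inv_sqrt_le_expR; apply: (@le_trans _ _ (59 / 50)); last by lra.
  have e1 := expR_ge1Dx (2 * - (3 / 40) : R).
  rewrite expRN; apply: (@le_trans _ _ (17 / 20)^-1); last by rewrite invf_div; lra.
  by rewrite lef_pV2 ?posrE ?expR_gt0//; lra.
have n0 : 0 <= n%:R :> R by [].
by rewrite -expRM_natl -expRD lee_fin ler_expR; lra.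
Qed.

Lemma noise_upper_tail :
  (P [set w | (4 * sigma2 * n%:R < sqnorm (noise beta XY w))%R] <=
   (expR (- (n%:R / 2)))%:E)%E.
Proof.
have sE : 1 - 2 * (4 * sigma2)^-1 * sigma2 = 2^-1 by field; rewrite gt_eqF.
have s1 : 2 * (4 * sigma2)^-1 * sigma2 < 1 by rewrite -subr_gt0 sE invr_gt0.
have := integral_noise_quad sigma0 iid s1; rewrite sE => E.
have mn : measurable_fun setT (fun w => sqnorm (noise beta XY w)).
  by apply: measurable_sqnorm; exact: measurable_noise.
apply: le_trans (chernoff_bound (f := fun w => (4 * sigma2)^-1 * sqnorm (noise beta XY w))
  (a := n%:R) (M := expR 2^-1 ^+ n) _ _ _ _) _.
- exact: measurable_set_lt.
- exact: measurable_funM.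
- move=> w /= H; rewrite ler_pdivlMl ?mulr_gt0//; lra.
- rewrite E lee_fin lerXn2r ?nnegrE ?invr_ge0 ?sqrtr_ge0 ?expR_ge0//.
  exact: inv_sqrt_half.
by rewrite -expRM_natl -expRD lee_fin ler_expR; lra.
Qed.

(* Chernoff's bound with the exponent 1 / (16 sigma2). *)
Lemma noise_excess_tail (l : nat) (Q : 'M[R]_n) (r : 'cV[R]_n) (c : R) :
  Q^T = Q -> Q *m Q = Q -> \tr Q = l%:R -> Q *m r = 0 ->
  (P [set w | (sqnorm r / 4 + c <=
     bilin Q (noise beta XY w) (noise beta XY w) -
     2 * bilin 1%:M r (noise beta XY w))%R] <=
   (expR (l%:R - sqnorm r / (128 * sigma2) - c / (16 * sigma2)))%:E)%E.
Proof.
move=> Qs Qi Qtr Qr; pose lam := (16 * sigma2)^-1.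
have lam0 : 0 <= lam by rewrite invr_ge0 mulr_ge0// ltW.
have s2E : Num.sqrt sigma2 ^+ 2 = sigma2 by rewrite sqr_sqrtr// ltW.
have sN0 : sigma2 != 0 by rewrite gt_eqF.
have lE : 1 - 2 * lam * Num.sqrt sigma2 ^+ 2 = 7 / 8 by rewrite s2E /lam; field.
have lams : 2 * lam * Num.sqrt sigma2 ^+ 2 < 1 by rewrite -subr_gt0 lE; lra.
have me := @measurable_noise _ _ _ P n d beta XY.
have Qh : Q *m ((- 2 * lam) *: r) = 0 by rewrite -scalemxAr Qr scaler0.
have := integral_expR_proj me lam0 lams (integral_noise_linear sigma0 iid) Qs Qi Qtr Qh.
rewrite lE => E.
have mb : measurable_fun setT (fun w =>
    lam * ((noise beta XY w)^T *m Q *m noise beta XY w) ord0 ord0 +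
    (((- 2 * lam) *: r)^T *m noise beta XY w) ord0 ord0).
  apply: measurable_funD.
    apply: measurable_funM => //.
    by apply: (@measurable_bilin _ _ _ _ _ (fun=> Q)) => //; exact: measurable_mx_cst.
  by apply: measurable_mxM => //; exact: measurable_mx_cst.
have bE w : (((- 2 * lam) *: r)^T *m noise beta XY w) ord0 ord0 =
    - 2 * lam * bilin 1%:M r (noise beta XY w).
  by rewrite -bilinZl /bilin mulmx1.
(* The linear term -2 lam r costs sigma2 / 2 * 4 lam^2 |r|^2 = |r|^2 / (128 sigma2), half of the
   gain lam |r|^2 / 4. Each dimension of [Q] costs (7/8)^(-1/2), at most e. *)
apply: le_trans (chernoff_bound (a := lam * (sqnorm r / 4 + c))
  (M := expR (l%:R + sqnorm r / (128 * sigma2))) _ mb _ _) _.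
- apply: measurable_set_le => //; apply: measurable_funB.
    by apply: (@measurable_bilin _ _ _ _ _ (fun=> Q)) => //; exact: measurable_mx_cst.
  apply: measurable_funM => //.
  by apply: (@measurable_bilin _ _ _ _ _ (fun=> 1%:M)) => //; exact: measurable_mx_cst.
- move=> w /= H; rewrite bE.
  have -> : lam * ((noise beta XY w)^T *m Q *m noise beta XY w) ord0 ord0 +
      - 2 * lam * bilin 1%:M r (noise beta XY w) =
      lam * (bilin Q (noise beta XY w) (noise beta XY w) -
        2 * bilin 1%:M r (noise beta XY w)) by rewrite /bilin; ring.
  exact: ler_wpM2l.
- rewrite E lee_fin expRD ler_pM ?exprn_ge0 ?invr_ge0 ?sqrtr_ge0 ?expR_ge0//.
    rewrite -[l%:R]mulr1 expRM_natl lerXn2r ?nnegrE ?invr_ge0 ?sqrtr_ge0 ?expR_ge0//.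
    apply: inv_sqrt_le_expR; have := expR_ge1Dx (2 * 1 : R) => e1.
    rewrite expRN; apply: (@le_trans _ _ 3^-1); last by lra.
    by rewrite lef_pV2 ?posrE ?expR_gt0//; lra.
  rewrite ler_expR s2E.
  have -> : (((- 2 * lam) *: r)^T *m ((- 2 * lam) *: r)) ord0 ord0 =
      (- 2 * lam) ^+ 2 * sqnorm r.
    by rewrite -sqnormZ sqnorm_bilin /bilin mulmx1.
  rewrite le_eqVlt; apply/orP; left; apply/eqP; rewrite /lam; field.
  by rewrite sN0.
rewrite -expRD lee_fin ler_expR le_eqVlt; apply/orP; left; apply/eqP.
by rewrite /lam; field; rewrite sN0.
Qed.

(* A finite union of events outside of which the restricted eigenvalue property
   holds on all vectors supported on H. *)
Definition ill_conditioned (H : {set 'I_d}) (B : 'M[R]_#|H|) (eta : R)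
    (X : 'M[R]_(n, d)) : Prop :=
  (exists j, 4 * n%:R < sqnorm (X *m col j (sel H *m B))) \/
  (exists k : {ffun 'I_#|H| -> bool * 'I_(441 * #|H|).+1},
    [/\ sqnorm (lattice_vec k : 'cV[R]__) <= 441 * #|H|%:R,
        9 / 10 <= eta ^+ 2 * sqnorm (lattice_vec k : 'cV[R]__) &
        eta ^+ 2 * sqnorm (X *m (sel H *m B *m lattice_vec k)) <= 51 / 100 * n%:R]).

(** The sum factors over coordinates. For one coordinate, exp(- i^2) <= 2^-i makes each sign
    contribute at most 2, and 4 <= e^2. *)
Lemma sum_expR_lattice (m M : nat) :
  \sum_(k : {ffun 'I_m -> bool * 'I_M.+1}) expR (- sqnorm (lattice_vec k)) <=
  expR (2 * m%:R) :> R.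
Proof.
pose g (p : bool * 'I_M.+1) : R := expR (- (((-1) ^+ p.1 * p.2%:R) ^+ 2)).
have -> : \sum_(k : {ffun 'I_m -> bool * 'I_M.+1}) expR (- sqnorm (lattice_vec k)) =
    \prod_(j < m) \sum_p g p.
  rewrite bigA_distr_bigA/=; apply: eq_bigr => k _.
  rewrite /sqnorm -sumrN expR_sum; apply: eq_bigr => j _; by rewrite mxE.
rewrite prodr_const card_ord [2 * _]mulrC expRM_natl.
have g0 : 0 <= \sum_p g p by apply: sumr_ge0 => p _; exact: expR_ge0.
rewrite lerXn2r ?nnegrE ?expR_ge0//.
have e1 := expR_ge1Dx (1 : R).
have geom N : \sum_(i < N) (2^-1 : R) ^+ i <= 2 - 2^-1 ^+ N * 2.
  elim: N => [|N IH]; first by rewrite big_ord0 expr0; lra.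
  by rewrite big_ord_recr/= exprS; lra.
have h (b : bool) : \sum_(i < M.+1) g (b, i) <= 2.
  apply: (@le_trans _ _ (\sum_(i < M.+1) (2^-1 : R) ^+ i)).
    apply: ler_sum => i _; rewrite /g/= exprMn sqrr_sign mul1r.
    apply: (@le_trans _ _ (expR (- i%:R))).
      rewrite ler_expR lerN2 -natrX ler_nat; case: (val i) => // p.
      by rewrite expnS leq_pmulr ?expn_gt0.
    rewrite -[i%:R]mulr1 -mulrN expRM_natl lerXn2r ?nnegrE ?expR_ge0 ?invr_ge0//.
    by rewrite expRN lef_pV2 ?posrE ?expR_gt0//; lra.
  apply: le_trans (geom _) _.
  by rewrite gerBl mulr_ge0// exprn_ge0// invr_ge0.
have -> : \sum_p g p = \sum_(b : bool) \sum_(i < M.+1) g (b, i).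
  by rewrite pair_bigA/=; apply: eq_bigr => -[].
rewrite big_bool/=; have := h true; have := h false.
have -> : expR 2 = expR 1 * expR 1 :> R by rewrite -expRD; congr expR; lra.
nra.
Qed.

(** The exponent 443 is 441 + 2: the squared radius of the lattice ball per dimension, plus the cost
    of [sum_expR_lattice]. The column events have the better rate n / 2 and fit under the same
    bound. *)
Lemma ill_conditioned_tail (H : {set 'I_d}) (B : 'M[R]_#|H|) (eta : R) :
  B^T *m ((sel H)^T *m Sigma *m sel H) *m B = 1%:M ->
  (P [set w | ill_conditioned B eta (data_X XY w)] <=
   (2 * expR (443 * #|H|%:R - n%:R / 50))%:E)%E.
Proof.
move=> BSB; pose W := sel H *m B; set m := #|H|.
have WSW u v : bilin Sigma (W *m u) (W *m v) = bilin 1%:M u v.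
  by rewrite bilin_mul -BSB /W trmx_mul !mulmxA.
pose A1 (j : 'I_#|H|) := [set w | 4 * n%:R < sqnorm (data_X XY w *m col j W)].
pose good (k : {ffun 'I_#|H| -> bool * 'I_(441 * #|H|).+1}) :=
  (sqnorm (lattice_vec k : 'cV[R]__) <= 441 * #|H|%:R) &&
  (9 / 10 <= eta ^+ 2 * sqnorm (lattice_vec k : 'cV[R]__)).
pose A2 k := if good k then
  [set w | (eta ^+ 2 * sqnorm (data_X XY w *m (W *m lattice_vec k)) <=
            51 / 100 * n%:R)%R] else set0.
have mA1 j : measurable (A1 j) by exact: measurable_set_lt.
have mA2 k : measurable (A2 k).
  rewrite /A2; case: ifP => // _; apply: measurable_set_le => //.
  exact: measurable_funM.
have -> : [set w | ill_conditioned B eta (data_X XY w)] =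
    [set w | exists j, A1 j w] `|` [set w | exists k, A2 k w].
  apply/seteqP; split => w /= [[i Ai]|[k Ak]]; [by left; exists i| |by left; exists i|].
    by right; exists k; rewrite /A2 /good; case: Ak => -> ->.
  by right; exists k; move: Ak; rewrite /A2; case: ifP => // /andP[].
apply: le_trans (measureU2 _ (measurable_set_exists mA1) (measurable_set_exists mA2)) _.
rewrite mulrDl mul1r EFinD; apply: leeD.
  apply: le_trans (probability_exists_le (P := P) (b := fun=> expR (- (n%:R / 2))) mA1 _) _.
    move=> j; apply: data_upper_tail.
    rewrite colE WSW -sqnorm_bilin /sqnorm (bigD1 j)//= big1 => [|i ij].
      by rewrite mxE !eqxx expr1n addr0.
    by rewrite mxE (negbTE ij) expr0n.
  rewrite lee_fin sumr_const card_ord -(mulr_natl (expR _)) expRD.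
  have n0 : 0 <= n%:R :> R by [].
  rewrite ler_pM ?expR_ge0//; last by rewrite ler_expR; lra.
  have := expR_ge1Dx (443 * m%:R : R); have : 0 <= m%:R :> R by [].
  rewrite -/m; lra.
(* In the ball, exp(441 m - |z|^2) >= 1. Inserting this factor keeps the tail bound valid and makes
   its sum over the whole index type computable. *)
pose b (k : {ffun 'I_#|H| -> bool * 'I_(441 * #|H|).+1}) : R :=
  expR (441 * m%:R - n%:R / 50) * expR (- sqnorm (lattice_vec k : 'cV[R]_m)).
apply: le_trans (probability_exists_le (P := P) (b := b) mA2 _) _.
  move=> k; rewrite /A2; case: ifP => [/andP[g1 g2]|_]; last first.
    by rewrite measure0 lee_fin mulr_ge0 ?expR_ge0.
  have e0 : 9 / 10 <=
      bilin Sigma (W *m (eta *: lattice_vec k)) (W *m (eta *: lattice_vec k)).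
    by rewrite WSW -sqnorm_bilin sqnormZ.
  have := data_lower_tail e0.
  rewrite (_ : [set w | _] = [set w | (eta ^+ 2 *
     sqnorm (data_X XY w *m (W *m lattice_vec k)) <= 51 / 100 * n%:R)%R]); last first.
    by apply/seteqP; split => w /=; rewrite -!scalemxAr sqnormZ.
  move=> /le_trans; apply; rewrite lee_fin /b -expRD ler_expR; move: g1; rewrite -/m; lra.
rewrite lee_fin /b -mulr_sumr.
apply: le_trans (ler_wpM2l (expR_ge0 _) (sum_expR_lattice _ _)) _.
by rewrite -expRD ler_expR; lra.
Qed.

End TailBounds.

(** * Support recovery *)

Section Counting.

(** The central binomial coefficient at least doubles from s to s + 1. Hence s is at most a multiple
    of log C(d, s), which absorbs the factors exponential in s from the lattice. *)
Lemma exp2_le_bin (d s : nat) : (2 * s <= d)%N -> (2 ^ s <= 'C(d, s))%N.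
Proof.
move=> sd; apply: leq_trans (leq_bin2l s sd).
elim: s {sd} => // s IHs; rewrite mulnS !addSn add0n binS expnS mul2n -addnn.
apply: leq_add; apply: leq_trans IHs _; last by exact: leq_bin2l.
by rewrite binS leq_addl.
Qed.

Lemma card_small_sets (d s : nat) : (2 * s <= d)%N ->
  (#|[set S : {set 'I_d} | (#|S| <= s)%N]%SET| <= s.+1 * 'C(d, s))%N.
Proof.
elim: s => [_|s IHs sd].
  rewrite (_ : [set _ | _]%SET = [set finset.set0]%SET) ?cards1 ?bin0//.
  by apply/setP => S; rewrite !inE leqn0 cards_eq0.
have {IHs} IHs := IHs (leq_trans (leq_mul (leqnn 2) (leqnSn s)) sd).
have -> : [set S : {set 'I_d} | (#|S| <= s.+1)%N]%SET =
    ([set S : {set 'I_d} | (#|S| <= s)%N] :|: [set S : {set 'I_d} | #|S| == s.+1])%SET.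
  by apply/setP => S; rewrite !inE leq_eqVlt ltnS orbC.
apply: leq_trans (leq_card_setU _ _) _; rewrite card_draws card_ord mulSn addnC.
(* C(d, s) <= C(d, s + 1) because (s + 1) C(d, s + 1) = (d - s) C(d, s) and s + 1 <= d - s. *)
rewrite leq_add2l; apply: leq_trans IHs _; rewrite leq_mul2l -(leq_pmul2l (ltn0Sn s)).
rewrite mul_bin_left leq_mul2r; apply/orP; right; apply/orP; right.
by rewrite leq_subRL; move: sd; rewrite mulnS; lia.
Qed.

Lemma card_small_sets_sqr (d s : nat) : (2 * s <= d)%N ->
  (#|[set S : {set 'I_d} | (#|S| <= s)%N]%SET| <= 'C(d, s) ^ 2)%N.
Proof.
move=> sd; apply: leq_trans (card_small_sets sd) _; rewrite expnS expn1 leq_mul2r.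
by rewrite (leq_trans (ltn_expl s (isT : (1 < 2)%N)) (exp2_le_bin sd)) orbT.
Qed.

(** Expand a product over indices: each contributes y if [S] and [S0] disagree on it and 1 if they
    agree, whatever [S0] is. *)
Lemma sum_expr_symdiff {R : comNzRingType} (d : nat) (S0 : {set 'I_d}) (y : R) :
  \sum_(S : {set 'I_d}) y ^+ (#|S0 :\: S| + #|S :\: S0|) = (1 + y) ^+ d.
Proof.
have expE (A : {set 'I_d}) : y ^+ #|A| = \prod_i (if i \in A then y else 1).
  by rewrite -prodr_const big_mkcond.
transitivity (\prod_(i < d) ((if i \in S0 then 1 else y) + (if i \in S0 then y else 1))).
  rewrite bigA_distr/=; apply: eq_bigr => S _; rewrite exprD !expE -big_split/=.
  apply: eq_bigr => i _; rewrite !finset.in_setD.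
  by case: (i \in S); case: (i \in S0); rewrite /= ?mulr1 ?mul1r.
rewrite (eq_bigr (fun=> 1 + y)) ?prodr_const ?card_ord//.
by move=> i _; case: (i \in S0) => //; rewrite addrC.
Qed.

End Counting.

(** The negation of the last hypothesis of [score_lt]. *)
Definition large_noise_excess {R : realType} {n d : nat} (beta : 'cV[R]_d) (tau : R)
    (S : {set 'I_d}) (X : 'M[R]_(n, d)) (e : 'cV[R]_n) : Prop :=
  sqnorm (residual X beta S) / 4 + n%:R * #|S :\: supp beta|%:R * tau / 4 <=
  bilin (excess_proj X beta S) e e - 2 * bilin 1%:M (residual X beta S) e.

Definition lattice_step {R : realType} (m : nat) : R := (20 * Num.sqrt m%:R)^-1.

Section EventMeasurability.
Context {disp : measure_display} {T : measurableType disp} {R : realType} {n d : nat}.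
Variable X : T -> 'M[R]_(n, d).
Hypothesis mX : measurable_mx X.

Let mXv (v : 'cV[R]_d) : measurable_fun setT (fun w => sqnorm (X w *m v)).
Proof.
by apply: measurable_sqnorm; apply: measurable_mxM => //; exact: measurable_mx_cst.
Qed.

Lemma measurable_ill_conditioned (H : {set 'I_d}) (B : 'M[R]_#|H|) (eta : R) :
  measurable [set w | ill_conditioned B eta (X w)].
Proof.
apply: measurableU.
  by apply: measurable_set_exists => j; exact: measurable_set_lt.
apply: measurable_set_exists => k /=.
pose c1 := sqnorm (lattice_vec k : 'cV[R]__) <= 441 * #|H|%:R.
pose c2 := 9 / 10 <= eta ^+ 2 * sqnorm (lattice_vec k : 'cV[R]__).
rewrite [Y in measurable Y](_ : _ = [set w | (c1 /\ c2) /\ (eta ^+ 2 *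
  sqnorm (X w *m (sel H *m B *m lattice_vec k)) <= 51 / 100 * n%:R)%R]).
  apply: measurable_set_prop; apply: measurable_set_le => //.
  exact: measurable_funM.
by apply/seteqP; split => w /=; [case=> h1 h2 h3; split|case=> -[h1 h2] h3; split].
Qed.

Lemma measurable_large_noise_excess (beta : 'cV[R]_d) (tau : R) (S : {set 'I_d})
    (e : T -> 'cV[R]_n) :
  measurable_mx e -> measurable [set w | large_noise_excess beta tau S (X w) (e w)].
Proof.
move=> me; have mr : measurable_mx (fun w => residual (X w) beta S).
  apply: measurable_mxM; first exact: measurable_proj_perp.
  by apply: measurable_mxM => //; exact: measurable_mx_cst.
apply: measurable_set_le.
  apply: measurable_funD => //; apply: measurable_funM => //.
  exact: measurable_sqnorm.
apply: measurable_funB.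
  apply: measurable_bilin => //.
  by apply: measurable_mxB; exact: measurable_proj_perp.
apply: measurable_funM => //.
by apply: (@measurable_bilin _ _ _ _ _ (fun=> 1%:M)) => //; exact: measurable_mx_cst.
Qed.

End EventMeasurability.

Section Support.
Context {disp : measure_display} {T : measurableType disp} {R : realType}
  (P : probability T R) {n d : nat} (beta : 'cV[R]_d) (Sigma : 'M[R]_d)
  (sigma2 tau : R) (XY : 'I_n -> {RV P >-> (d.-tuple R * R)%type}).
Hypotheses (sigma0 : 0 < sigma2) (tau0 : 0 < tau) (n0 : (0 < n)%N).
Hypothesis iid : iid_linear_model beta Sigma sigma2 XY.
Hypothesis Spd : posdef Sigma.

Let S0 := supp beta.

Lemma well_conditioned_restricted_eigenvalue (X : 'M[R]_(n, d)) (H : {set 'I_d})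
    (B : 'M[R]_#|H|) : (0 < #|H|)%N ->
  B^T *m ((sel H)^T *m Sigma *m sel H) *m B = 1%:M ->
  ~ ill_conditioned B (lattice_step #|H|) X ->
  forall u : 'cV[R]_d, (forall j, j \notin H -> u j ord0 = 0) ->
    n%:R / 2 * bilin Sigma u u <= sqnorm (X *m u).
Proof.
move=> H0 BSB wc u uH; have m0 : 0 < #|H|%:R :> R by rewrite ltr0n.
apply: (restricted_eigenvalue_lattice (eta := lattice_step #|H|) Spd BSB) uH.
- by rewrite invr_gt0 mulr_gt0// sqrtr_gt0.
- rewrite /lattice_step exprVn exprMn sqr_sqrtr ?(ltW m0)//.
  by field; rewrite gt_eqF.
- by move=> j; rewrite leNgt; apply/negP => jX; apply: wc; left; exists j.
- move=> k k1 k2; rewrite ltNge; apply/negP => k3; apply: wc; right; exists k.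
  by split.
Qed.

(** With [X] frozen, either it is ill-conditioned and the event is empty, or [noise_excess_tail]
    applies. As |h|^2 >= 2 n k tau, every missing index contributes n tau / (64 sigma2) to the
    exponent, and so does every extra one through l n tau / 4; hence a power of one number. *)
Lemma large_noise_excess_tail (S : {set 'I_d}) (B : 'M[R]_#|S :|: S0|) :
  (0 < #|S :|: S0|)%N ->
  B^T *m ((sel (S :|: S0))^T *m Sigma *m sel (S :|: S0)) *m B = 1%:M ->
  (forall a : 'cV[R]_#|S|, 4 * tau * #|S0 :\: S|%:R <=
     bilin Sigma (beta - sel S *m a) (beta - sel S *m a)) ->
  (P [set w | ~ ill_conditioned B (lattice_step #|S :|: S0|) (data_X XY w) /\
              large_noise_excess beta tau S (data_X XY w) (noise beta XY w)] <=
   (expR (1 - n%:R * tau / (64 * sigma2)) ^+ (#|S0 :\: S| + #|S :\: S0|))%:E)%E.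
Proof.
move=> H0 BSB signal.
apply: (probability_design_noise_le (K := fun X e =>
  ~ ill_conditioned B (lattice_step #|S :|: S0|) X /\
  large_noise_excess beta tau S X e) iid).
  have mX : measurable_mx (fun x : n.-tuple (d.-tuple R) * n.-tuple R => tuple_mx x.1).
    by move=> i j; exact: (measurableT_comp (measurable_tuple_mx i j) measurable_fst).
  have me : measurable_mx (fun x : n.-tuple (d.-tuple R) * n.-tuple R => tuple_col x.2).
    by move=> i j; exact: (measurableT_comp (measurable_tuple_col i j) measurable_snd).
  apply: measurableI; last exact: measurable_large_noise_excess.
  by apply: measurableC; exact: measurable_ill_conditioned.
move=> X; have [ill|wc] := pselect (ill_conditioned B (lattice_step #|S :|: S0|) X).
  rewrite (_ : [set w | _] = set0) ?measure0 ?lee_fin ?exprn_ge0 ?expR_ge0//.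
  by apply/seteqP; split => w //= -[].
have RE := well_conditioned_restricted_eigenvalue H0 BSB wc.
rewrite (_ : [set w | _] =
  [set w | large_noise_excess beta tau S X (noise beta XY w)]); last first.
  by apply/seteqP; split => w /=; [case|split].
have q0 := residual_lower_bound RE signal.
apply: le_trans (noise_excess_tail sigma0 iid _ _ _ _ _) _.
- exact: excess_proj_sym.
- exact: (excess_proj_idem n0 Spd RE).
- exact: (excess_proj_trace n0 Spd RE).
- exact: (excess_proj_residual n0 Spd RE).
rewrite lee_fin -expRM_natl ler_expR natrD -/S0.
set q := sqnorm _ in q0 *; set k := #|S0 :\: S|%:R in q0 *; set l := #|S :\: S0|%:R.
have k0 : 0 <= k by [].
have H1 : 2 * n%:R * k * tau / (128 * sigma2) <= q / (128 * sigma2).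
  by rewrite ler_wpM2r// invr_ge0 mulr_ge0// ltW.
have sN0 : sigma2 != 0 by rewrite gt_eqF.
have -> : n%:R * l * tau / 4 / (16 * sigma2) = l * (n%:R * tau / (64 * sigma2)).
  by field.
have -> : (k + l) * (1 - n%:R * tau / (64 * sigma2)) =
    k + l - 2 * n%:R * k * tau / (128 * sigma2) - l * (n%:R * tau / (64 * sigma2)).
  by field.
lra.
Qed.

(** Ill-conditioning is charged equally to all small sets. The noise bound depends on [S] only
    through its symmetric difference with [S0], so it is summed over all subsets; the -1 removes the
    term of [S0]. *)
Lemma support_recovery_failure (sbar : nat) (Shat : T -> {set 'I_d}) :
  (#|S0| <= sbar)%N -> (2 * sbar <= n)%N -> 16 * sigma2 <= n%:R * tau ->
  (forall (S : {set 'I_d}) (a : 'cV[R]_#|S|), (#|S| <= sbar)%N ->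
     4 * tau * #|S0 :\: S|%:R <= bilin Sigma (beta - sel S *m a) (beta - sel S *m a)) ->
  (forall S, measurable [set w | Shat w = S]) ->
  (forall w, is_argmin sbar tau (data_X XY w) (data_Y XY w) (Shat w)) ->
  (P (~` [set w | Shat w = S0]) <=
   (expR (- (n%:R / 2)) +
    #|[set S : {set 'I_d} | (#|S| <= sbar)%N]%SET|%:R *
      (2 * expR (443 * (2 * sbar%:R) - n%:R / 50)) +
    ((1 + expR (1 - n%:R * tau / (64 * sigma2))) ^+ d - 1))%:E)%E.
Proof.
move=> S0s sn ntau signal mShat argm.
set z := 2 * expR _; set y := expR (1 - _).
have z0 : 0 <= z by rewrite mulr_ge0 ?expR_ge0.
have y0 : 0 <= y by exact: expR_ge0.
have orth (H : {set 'I_d}) : exists B : 'M[R]_#|H|,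
    B^T *m ((sel H)^T *m Sigma *m sel H) *m B = 1%:M.
  by apply/posdef_orthonormal/posdef_congr => // x; exact: sel_inj.
pose B H := projT1 (cid (orth H)).
have BE H : (B H)^T *m ((sel H)^T *m Sigma *m sel H) *m B H = 1%:M := projT2 (cid (orth H)).
pose ill S (X : 'M[R]_(n, d)) :=
  ill_conditioned (B (S :|: S0)%SET) (lattice_step #|S :|: S0|) X.
pose comp S := (S != S0) && (#|S| <= sbar)%N.
(* The lattice step is the inverse of 20 sqrt m, so the union must be nonempty. *)
have comp_gt0 S : S != S0 -> (0 < #|S :|: S0|)%N.
  rewrite card_gt0; apply: contraNneq => SS0.
  have := finset.subsetUl S S0; have := finset.subsetUr S S0; rewrite SS0 !finset.subset0.
  by move=> /eqP -> /eqP ->.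
pose E0 := [set w | (4 * sigma2 * n%:R < sqnorm (noise beta XY w))%R].
pose E1 S := if comp S then [set w | ill S (data_X XY w)] else set0.
pose E2 S := if comp S then [set w | ~ ill S (data_X XY w) /\
  large_noise_excess beta tau S (data_X XY w) (noise beta XY w)] else set0.
have mX := @measurable_data_X _ _ _ P n d XY.
have me := @measurable_noise _ _ _ P n d beta XY.
have mE0 : measurable E0 by apply: measurable_set_lt => //; exact: measurable_sqnorm.
have mE1 S : measurable (E1 S).
  by rewrite /E1; case: ifP => // _; exact: measurable_ill_conditioned.
have mE2 S : measurable (E2 S).
  rewrite /E2; case: ifP => // _; apply: measurableI.
    by apply: measurableC; exact: measurable_ill_conditioned.
  exact: measurable_large_noise_excess.
have mex1 := measurable_set_exists mE1; have mex2 := measurable_set_exists mE2.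
have sub : ~` [set w | Shat w = S0] `<=`
    (E0 `|` [set w | exists S, E1 S w]) `|` [set w | exists S, E2 S w].
  move=> w /= SN; apply: contrapT => /not_orP[/not_orP[nE0 nE1] nE2].
  have [Ssb amin] := argm w; set S := Shat w in SN Ssb amin.
  have SS0 : S != S0 by apply/eqP.
  have cS : comp S by rewrite /comp SS0.
  have wc : ~ ill S (data_X XY w) by move=> iw; apply: nE1; exists S; rewrite /E1 cS.
  have ne : ~ large_noise_excess beta tau S (data_X XY w) (noise beta XY w).
    by move=> lw; apply: nE2; exists S; rewrite /E2 cS.
  have RE := well_conditioned_restricted_eigenvalue (comp_gt0 S SS0) (BE _) wc.
  have : score tau (data_X XY w) (data_Y XY w) S0 < score tau (data_X XY w) (data_Y XY w) S.
    rewrite (data_YE beta); apply: (score_lt (sigma2 := sigma2) n0 Spd RE) => //.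
    - by move=> a; exact: signal.
    - by apply: leq_trans sn; rewrite leq_mul2l Ssb orbT.
    - by apply: leq_trans sn; rewrite leq_mul2l S0s orbT.
    - by rewrite leNgt; apply/negP.
    - by rewrite ltNge; apply/negP.
  by rewrite ltNge amin.
apply: le_trans (le_measure P _ _ sub) _.
- by apply: mem_set; apply: measurableC; exact: mShat.
- by apply: mem_set; apply: measurableU => //; exact: measurableU.
apply: le_trans (measureU2 _ (measurableU _ _ mE0 mex1) mex2) _; rewrite EFinD.
apply: leeD; first (apply: le_trans (measureU2 _ mE0 mex1) _; rewrite EFinD; apply: leeD).
- exact: (noise_upper_tail sigma0 iid).
- apply: le_trans (probability_exists_le (P := P)
    (b := fun S : {set 'I_d} => if (#|S| <= sbar)%N then z else 0) mE1 _) _.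
    move=> S; rewrite /E1 /comp; case: ifPn => [/andP[SS0 Ssb]|_]; last first.
      by rewrite measure0 lee_fin; case: ifP.
    rewrite Ssb; apply: le_trans (ill_conditioned_tail iid _ (BE _)) _.
    rewrite lee_fin ler_wpM2l// ler_expR.
    have c2 : #|S :|: S0|%:R <= 2 * sbar%:R :> R.
      rewrite -natrM ler_nat mul2n -addnn.
      by apply: leq_trans (leq_card_setU _ _) _; exact: leq_add.
    lra.
  rewrite lee_fin -big_mkcond/= sumr_const -[X in _ *+ X]cardsE mulr_natl.
  by rewrite (eq_card (B := mem [set S : {set 'I_d} | (#|S| <= sbar)%N]%SET)).
- apply: le_trans (probability_exists_le (P := P)
    (b := fun S : {set 'I_d} => if S == S0 then 0
      else y ^+ (#|S0 :\: S| + #|S :\: S0|)) mE2 _) _.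
    move=> S; rewrite /E2 /comp; case: ifPn => [/andP[SS0 Ssb]|_]; last first.
      by rewrite measure0 lee_fin; case: ifP => // _; exact: exprn_ge0.
    rewrite (negbTE SS0); apply: large_noise_excess_tail => //; first exact: comp_gt0.
    by move=> a; exact: signal.
  rewrite lee_fin -(sum_expr_symdiff S0 y) (bigD1 S0)//= eqxx add0r.
  rewrite [in X in _ <= X](bigD1 S0)//= finset.setDv cards0 expr0 addrAC subrr add0r.
  by rewrite le_eqVlt; apply/orP; left; apply/eqP; apply: eq_bigr => S /negbTE ->.
Qed.

End Support.

Section Numerics.
Context {R : realType}.

Lemma ln2_ge : 2^-1 <= ln (2 : R).
Proof.
rewrite -[leLHS]expRK ler_ln ?posrE ?expR_gt0//.
have e1 := expR_ge1Dx (- 2^-1 : R).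
rewrite -[leLHS]invrK -expRN -[leRHS]invrK lef_pV2 ?posrE ?expR_gt0 ?invr_gt0//; lra.
Qed.

(* Used with L = ln 'C(d, sbar) and x = n tau / sigma2; each of the three error
   terms is at most delta / 4. *)
Lemma failure_bound (d : nat) (s n x delta L : R) :
  (0 < d)%N -> 0 < delta -> 0 <= s -> 2^-1 <= L -> s <= 2 * L -> 2^-1 <= ln (d%:R : R) ->
  0 <= ln (1 / delta) ->
  1000 * 100 * (L + ln (1 / delta)) <= n ->
  1000 * 100 * (ln d%:R + ln (1 / delta)) <= 4 * x ->
  expR (- (n / 2)) + expR (2 * L) * (2 * expR (443 * (2 * s) - n / 50)) +
    ((1 + expR (1 - x / 64)) ^+ d - 1) <= delta.
Proof.
move=> d0 delta0 s0 L2 sL d2 D0 nC xC; set D := ln (1 / delta) in D0 nC xC *.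
have dE : delta = expR (- D).
  by rewrite /D div1r lnV ?posrE// opprK lnK ?posrE.
have e1 := expR_ge1Dx (1 : R).
have e3 : expR (- 3) <= 8^-1 :> R.
  have -> : expR (- 3) = (expR 1)^-1 ^+ 3 :> R.
    by rewrite -expRN -expRM_natl; congr expR; lra.
  have -> : 8^-1 = 2^-1 ^+ 3 :> R by field.
  by rewrite lerXn2r ?nnegrE ?invr_ge0 ?expR_ge0// lef_pV2 ?posrE ?expR_gt0//; lra.
have small u : u <= - D - 3 -> expR u <= delta / 8.
  move=> uD; apply: (@le_trans _ _ (expR (- D) * expR (- 3))).
    by rewrite -expRD ler_expR.
  by rewrite -dE ler_wpM2l// ltW.
have t1 : expR (- (n / 2)) <= delta / 8 by apply: small; lra.
(* This term dictates the size of the constant: s <= 2 L bounds 2 L + 886 s by 1774 L, against n /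
   50 >= 2000 (L + D). *)
have t2 : expR (2 * L) * (2 * expR (443 * (2 * s) - n / 50)) <= delta / 4.
  have := small (2 * L + (443 * (2 * s) - n / 50)).
  rewrite expRD; set a := expR _; set b := expR _ => H.
  have {}H : a * b <= delta / 8 by apply: H; lra.
  lra.
set y := expR (1 - x / 64).
have dy : d%:R * y <= delta / 8.
  rewrite -[d%:R](@lnK R) ?posrE ?ltr0n// -expRD; apply: small; lra.
have y0 : 0 <= y by exact: expR_ge0.
have dy0 : 0 <= d%:R * y by rewrite mulr_ge0.
have dy1 : d%:R * y <= 2^-1.
  apply: le_trans dy _; have : delta <= 1 by rewrite dE -expR0 ler_expR; lra.
  lra.
(* The chain is (1 + y)^d <= exp(d y) <= 1 / (1 - d y) <= 1 + 2 d y, the last step since d y <=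
   1/2. *)
have t3 : (1 + y) ^+ d <= 1 + 2 * (d%:R * y).
  apply: (@le_trans _ _ (expR (d%:R * y))).
    by rewrite expRM_natl lerXn2r ?nnegrE ?expR_ge0 ?addr_ge0// expR_ge1Dx.
  have eN := expR_ge1Dx (- (d%:R * y)).
  rewrite -[leLHS]invrK -expRN; apply: (@le_trans _ _ (1 - d%:R * y)^-1).
    by rewrite lef_pV2 ?posrE ?expR_gt0//; lra.
  rewrite invf_ple ?posrE; last 2 first.
  - lra.
  - lra.
  rewrite -div1r ler_pdivrMr; last lra.
  nra.
lra.
Qed.

End Numerics.

Theorem theorem4p1 (R : realType) :
  exists C : R, 0 < C /\
  forall (d sbar : nat) (beta_min omega sigma2 delta : R),
    (0 < d)%N -> (2 * sbar <= d)%N ->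
    0 < beta_min -> 0 < omega -> 0 < sigma2 -> 0 < delta < 1 ->
  forall (beta : 'cV[R]_d) (Sigma : 'M[R]_d),
    Theta sbar beta_min beta -> Omega sbar omega Sigma ->
  forall (n : nat) (disp : measure_display) (T : measurableType disp)
    (P : probability T R) (XY : 'I_n -> {RV P >-> (d.-tuple R * R)%type}),
    iid_linear_model beta Sigma sigma2 XY ->
  forall (tau : R), tau = 4^-1 * omega * beta_min ^+ 2 ->
  forall (Shat : T -> {set 'I_d}),
    (forall S, measurable [set w | Shat w = S]) ->
    (forall w, is_argmin sbar tau (data_X XY w) (data_Y XY w) (Shat w)) ->
    C * Num.max
          ((ln d%:R + ln (1 / delta)) / (beta_min ^+ 2 * omega / sigma2))
          (ln ('C(d, sbar))%:R + ln (1 / delta)) <= n%:R ->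
    ((1 - delta)%:E <= P [set w | Shat w = supp beta])%E.
Proof.
have [C [C0 CE]] : exists C : R, 0 < C /\ C = 1000 * 100.
  by exists (1000 * 100); split; first by rewrite mulr_gt0 ?ltr0n.
exists C; split; first exact: C0.
move=> d sbar beta_min omega sigma2 delta d0 sd bm0 om0 sg0 /andP[delta0 delta1].
move=> beta Sigma bTheta SOmega n disp T P XY iid tau tauE Shat.
move=> mShat argm nC.
have [bs _] := bTheta; have [Spd _] := SOmega.
(* For sbar = 0 the logarithm of the binomial vanishes and bounds nothing, but the empty set is then
   the only candidate and recovery is certain. *)
case: sbar => [|sb] in sd bTheta SOmega argm nC bs *.
  have supp0 : supp beta = finset.set0.
    by apply/eqP; rewrite -cards_eq0 -leqn0.
  rewrite (_ : [set w | _] = setT).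
    by rewrite probability_setT lee_fin; lra.
  apply/seteqP; split => w //= _; have [Sw _] := argm w.
  by apply/eqP; rewrite supp0 -cards_eq0 -leqn0.
set sbar := sb.+1 in sd bTheta SOmega argm nC bs.
have d2 : (2 <= d)%N by apply: leq_trans sd; rewrite leq_pmulr.
set L := ln ('C(d, sbar))%:R in nC.
have bin2 := exp2_le_bin sd.
have bin0 : (0 < 'C(d, sbar))%N by apply: leq_trans bin2; rewrite expn_gt0.
have l2 := @ln2_ge R.
have sL : sbar%:R <= 2 * L.
  have : ln ((2 : R) ^+ sbar) <= L.
    by rewrite /L ler_ln ?posrE ?exprn_gt0 ?ltr0n// -natrX ler_nat.
  rewrite lnXn// -(mulr_natl (ln 2)).
  have := ler_wpM2l (ler0n R sbar) l2; lra.
have s1 : 1 <= sbar%:R :> R by rewrite ler1n.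
have L2 : 2^-1 <= L by lra.
have ld2 : 2^-1 <= ln (d%:R : R).
  by apply: le_trans l2 _; rewrite ler_ln ?posrE ?ltr0n// ler_nat.
have D0 : 0 <= ln (1 / delta).
  by rewrite ln_ge0// div1r -[leLHS]invr1 lef_pV2 ?posrE// ltW.
have tau0 : 0 < tau by rewrite tauE !mulr_gt0// ?invr_gt0// exprn_gt0.
have nC2 : C * (L + ln (1 / delta)) <= n%:R.
  by apply: le_trans nC; rewrite ler_wpM2l ?(ltW C0)// le_max lexx orbT.
pose x := n%:R * tau / sigma2.
have sN0 : sigma2 != 0 by rewrite gt_eqF.
(* As 4 tau = omega beta_min^2, the quantity 4 x is [n] times the signal-to-noise ratio. *)
have nC1 : C * (ln d%:R + ln (1 / delta)) <= 4 * x.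
  have r0 : 0 < beta_min ^+ 2 * omega / sigma2 by rewrite !mulr_gt0// ?invr_gt0// exprn_gt0.
  have -> : 4 * x = n%:R * (beta_min ^+ 2 * omega / sigma2) by rewrite /x tauE; field.
  rewrite -ler_pdivrMr// -[X in X <= _]mulrA; apply: le_trans nC.
  by rewrite ler_wpM2l ?(ltW C0)// le_max lexx.
rewrite CE in nC1 nC2.
have n0 : (0 < n)%N by rewrite -(ltr0n R); lra.
have sn : (2 * sbar <= n)%N by rewrite -(ler_nat R) natrM; lra.
have ntau : 16 * sigma2 <= n%:R * tau.
  have -> : n%:R * tau = x * sigma2 by rewrite /x divfK.
  by rewrite ler_pM2r//; lra.
have signal (S : {set 'I_d}) (a : 'cV[R]_#|S|) : (#|S| <= sbar)%N ->
    4 * tau * #|supp beta :\: S|%:R <=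
    bilin Sigma (beta - sel S *m a) (beta - sel S *m a).
  move=> Ss; have -> : 4 * tau = omega * beta_min ^+ 2 by rewrite tauE; field.
  exact: (signal_lower_bound a bm0 om0 bTheta SOmega Ss).
have fail := support_recovery_failure sg0 tau0 n0 iid Spd bs sn ntau signal mShat argm.
have [mA PA] : measurable [set w | Shat w = supp beta] /\
  P (~` [set w | Shat w = supp beta]) = (1 - P [set w | Shat w = supp beta])%E.
  by split; [exact: mShat|rewrite probability_setC].
have bound : (P (~` [set w | Shat w = supp beta]) <= delta%:E)%E.
  apply: le_trans fail _; rewrite lee_fin.
  apply: le_trans (failure_bound d0 delta0 _ L2 sL ld2 D0 nC2 nC1); last by [].
  rewrite lerD//; last first.
    by rewrite /x (_ : n%:R * tau / (64 * sigma2) = n%:R * tau / sigma2 / 64)//; field.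
  rewrite lerD2l ler_wpM2r ?mulr_ge0 ?expR_ge0//.
  rewrite expRM_natl /L lnK ?posrE ?ltr0n// -natrX ler_nat.
  exact: card_small_sets_sqr.
move: bound; rewrite PA -(fineK (fin_num_measure P _ mA)) -EFinB !lee_fin.
lra.
Qed.
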